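(* Let $\Lambda$ be a commutative discrete valuation ring. For an embedding $X$ of $\Lambda$-modules, the following invariants are equivalent in the sense that each one determines both of the others: (1) the socle tableau $\Sigma_X$ of $X$; (2) the LR-tableau $\Gamma^*_X=\Gamma_{X^*}$ of the dual embedding $X^*$; (3) the Hom-matrix $H_X=(h_\ell^m)_{\ell,m}$, where $h_\ell^m=\mathrm{len}\,\mathrm{Hom}_{\mathcal S}(P_\ell^m,X)$ for $m\ge 1$, $0\le\ell\le m$. That is, for any two embeddings $X,Y$, the conditions $\Sigma_X=\Sigma_Y$, $\Gamma^*_X=\Gamma^*_Y$ and $H_X=H_Y$ are equivalent.
   Context: Let $p$ be a generator of the maximal ideal of $\Lambda$. All $\Lambda$-modules have finite length; $\mathrm{len}$ denotes composition length. For a partition $\lambda=(\lambda_1\ge\dots\ge\lambda_n\geq 1)$ put $N_\lambda=\Lambda/(p^{\lambda_1})\oplus\cdots\oplus\Lambda/(p^{\lambda_n})$; a $\Lambda$-module $M$ has type $\lambda$ if $M\cong N_\lambda$. An embedding $X=(A\subset B)$ consists of a $\Lambda$-module $B$ and a submodule $A$. $\mathcal S=\mathcal S(\Lambda)$ is the category of embeddings; a morphism $(A\subset B)\to(A'\subset B')$ is a $\Lambda$-homomorphism $f:B\to B'$ with $f(A)\subset A'$ (commutative diagrams), so the Hom-groups are $\Lambda$-modules. $\mathrm{soc}^\ell A=\{a\in A:p^\ell a=0\}$ and $\mathrm{rad}^\ell A=p^\ell A$. Pickets: for $m\ge1$, $0\le\ell\le m$, $P^m=\Lambda/(p^m)$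 and $P^m_\ell=(\mathrm{soc}^\ell P^m\subset P^m)$. Tableaux: the Young diagram of $\lambda$ has columns of lengths $\lambda_1,\lambda_2,\dots$. Let $X=(A\subset B)$ where $A,B,B/A$ have types $\alpha,\beta,\gamma$, and $s=\alpha_1$. The socle tableau $\Sigma_X$ is given by the decreasing sequence $(\sigma^{(0)},\dots,\sigma^{(s)})$ where $\sigma^{(i)}$ is the type of $B/\mathrm{soc}^iA$; as a filling of the skew diagram $\beta\setminus\gamma$, the boxes of $\sigma^{(\ell-1)}\setminus\sigma^{(\ell)}$ have entry $\ell$. The LR-tableau $\Gamma_X$ is given by the increasing sequence $(\gamma^{(0)},\dots,\gamma^{(s)})$ where $\gamma^{(i)}$ is the type of $B/p^iA$; the boxes of $\gamma^{(\ell)}\setminus\gamma^{(\ell-1)}$ have entry $\ell$. Duality: let $E$ be the injective envelope of $\Lambda/(p)$ and $DM=\mathrm{Hom}_\Lambda(M,E)$. For $X=(A\subset B)$ with $C=B/A$ and canonical map $\pi:B\to C$, the dual embedding $X^*$ (also written $DX$) is given by the inclusion $\mathrm{Hom}_\Lambda(\pi,E):DC\to DB$. *)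

(* Defs.v *)
From HB Require Import structures.
From mathcomp Require Import all_boot all_order all_algebra.
From mathcomp Require Import ring_quotient generic_quotient.
From mathcomp Require Import boolp classical_sets functions.

Set Implicit Arguments.
Unset Strict Implicit.
Unset Printing Implicit Defensive.

Import GRing.Theory.
Local Open Scope ring_scope.
Local Open Scope quotient_scope.

(* Submodules are MathComp's bundled predicates submodClosed; two of them are
   compared extensionally, with =i. *)

Section SubmoduleAsModule.
Variables (R : pzRingType) (M : lmodType R) (N : submodClosed M).

Inductive submod_of := SubmodOf x & x \in N.
Definition submod_val u := let: SubmodOf x _ := u in x.
HB.instance Definition _ := [isSub for submod_val].
HB.instance Definition _ := [Choice of submod_of by <:].
HB.instance Definition _ := [SubChoice_isSubLmodule of submod_of by <:].

End SubmoduleAsModule.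

Section QuotientModule.
Variables (R : pzRingType) (M : lmodType R) (N : submodClosed M).

(* Quotient.quot expects a zmodClosed, from which submodClosed does not inherit. *)
Definition zmod_pred : {pred M} := N.
Lemma zmod_pred_closed : zmod_closed zmod_pred.
Proof. exact: submodClosedP N. Qed.
HB.instance Definition _ := GRing.isZmodClosed.Build M zmod_pred zmod_pred_closed.

Definition quotmod : Type := Quotient.quot zmod_pred.
HB.instance Definition _ := GRing.Zmodule.on quotmod.
HB.instance Definition _ := EqQuotient.on quotmod.
HB.instance Definition _ := ZmodQuotient.on quotmod.

Definition quot_scale (a : R) : quotmod -> quotmod :=
  lift_op1 quotmod (GRing.scale a).

Lemma pi_scale a : {morph \pi_quotmod : x / a *: x >-> quot_scale a x}.
Proof.
move=> x; unlock quot_scale; apply/eqP; rewrite piE Quotient.equivE.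
have: x - repr (\pi_quotmod x) \in zmod_pred.
  by rewrite Quotient.idealrBE reprK.
by rewrite -scalerBr; exact: rpredZ.
Qed.
Canonical pi_scale_morph a := PiMorph1 (pi_scale a).

Lemma quot_scaleA a b x : quot_scale a (quot_scale b x) = quot_scale (a * b) x.
Proof. by rewrite -[x]reprK !piE scalerA. Qed.
Lemma quot_scale1 : left_id 1 quot_scale.
Proof. by move=> x; rewrite -[x]reprK !piE scale1r. Qed.
Lemma quot_scaleDr : right_distributive quot_scale +%R.
Proof. by move=> a x y; rewrite -[x]reprK -[y]reprK !piE scalerDr. Qed.
Lemma quot_scaleDl x : {morph quot_scale^~ x : a b / a + b}.
Proof. by move=> a b; rewrite -[x]reprK !piE scalerDl. Qed.
HB.instance Definition _ := GRing.Zmodule_isLmodule.Build R quotmod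
  quot_scaleA quot_scale1 quot_scaleDr quot_scaleDl.

Definition quot_proj (x : M) : quotmod := \pi x.
Lemma quot_proj_linear : linear quot_proj.
Proof. by move=> a x y; rewrite /quot_proj !piE. Qed.
HB.instance Definition _ :=
  GRing.isLinear.Build R M quotmod _ quot_proj quot_proj_linear.

End QuotientModule.

Section Length.
Variables (R : pzRingType) (M : lmodType R).

(* c 0 < c 1 < ... < c n; the values of c beyond n are irrelevant. *)
Definition composition_series (n : nat) (c : nat -> submodClosed M) : Prop :=
  [/\ c 0%N =i pred1 0, c n =i predT &
      forall i, (i < n)%N ->
        [/\ {subset c i <= c i.+1}, ~ {subset c i.+1 <= c i} &
            forall N : submodClosed M,
              {subset c i <= N} -> {subset N <= c i.+1} ->
              N =i c i \/ N =i c i.+1]].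

Definition has_length (n : nat) : Prop := exists c, composition_series n c.
Definition finite_length : Prop := exists n, has_length n.

(* Equals 0 by default when M does not have finite length. *)
Definition len : nat := xget 0%N [set n | has_length n]%classic.

End Length.

Section Hom.
Variables (R : comPzRingType) (M N : lmodType R).

Definition hom_pred : {pred (M -> N)} := fun f => `[< linear f >].
Lemma hom_pred_closed : submod_closed hom_pred.
Proof.
split; first by apply/asboolP => a x y; rewrite /= scaler0 addr0.
move=> c f g /asboolP fl /asboolP gl; apply/asboolP => a x y.
rewrite -[LHS]/(c *: f (a *: x + y) + g (a *: x + y)) fl gl.
rewrite -[RHS]/(a *: (c *: f x + g x) + (c *: f y + g y)).
by rewrite !scalerDr !scalerA [a * c]mulrC addrACA.
Qed.
HB.instance Definition _ := GRing.isSubmodClosed.Build R (M -> N) hom_pred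
  hom_pred_closed.

Definition hom_mod : lmodType R := submod_of hom_pred.

Definition hom_fun (f : hom_mod) : M -> N := val f.
Lemma hom_fun_linear f : linear (hom_fun f).
Proof. by case: f => f fl; apply/asboolP. Qed.
HB.instance Definition _ f :=
  GRing.isLinear.Build R M N _ (hom_fun f) (hom_fun_linear f).

Lemma hom_of_subproof (f : {linear M -> N}) : (f : M -> N) \in hom_pred.
Proof. by apply/asboolP; exact: linearP. Qed.
Definition hom_of (f : {linear M -> N}) : hom_mod := SubmodOf (hom_of_subproof f).

End Hom.

(* Hom(f, E) *)
Definition hom_precomp (R : comPzRingType) (E M N : lmodType R)
    (f : {linear M -> N}) (h : hom_mod N E) : hom_mod M E :=
  hom_of (hom_fun h \o f).

Section SocleRadical.
Variables (R : comPzRingType) (p : R) (l : nat).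
Variables (M : lmodType R) (A : submodClosed M).

Definition soc_pred : {pred M} := fun x => (x \in A) && (p ^+ l *: x == 0).
Lemma soc_pred_closed : submod_closed soc_pred.
Proof.
split; first by rewrite unfold_in /= rpred0 scaler0 eqxx.
move=> c x y /andP[xA /eqP x0] /andP[yA /eqP y0].
rewrite unfold_in /= rpredD ?rpredZ //=.
by rewrite scalerDr scalerA mulrC -scalerA x0 y0 scaler0 addr0.
Qed.
HB.instance Definition _ := GRing.isSubmodClosed.Build R M soc_pred
  soc_pred_closed.
Definition soc : submodClosed M := soc_pred.

Definition rad_pred : {pred M} :=
  fun x => `[< exists2 a, a \in A & x = p ^+ l *: a >].
Lemma rad_pred_closed : submod_closed rad_pred.
Proof.
split; first by apply/asboolP; exists 0; rewrite ?rpred0 ?scaler0.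
move=> c _ _ /asboolP[a aA ->] /asboolP[b bA ->]; apply/asboolP.
exists (c *: a + b); first by rewrite rpredD ?rpredZ.
by rewrite scalerDr !scalerA mulrC.
Qed.
HB.instance Definition _ := GRing.isSubmodClosed.Build R M rad_pred
  rad_pred_closed.
Definition rad : submodClosed M := rad_pred.

End SocleRadical.

Section FullSubmodule.
Variables (R : pzRingType) (M : lmodType R).

Definition full_pred : {pred M} := fun=> true.
Lemma full_pred_closed : submod_closed full_pred.
Proof. by []. Qed.
HB.instance Definition _ := GRing.isSubmodClosed.Build R M full_pred
  full_pred_closed.
Definition full_submod : submodClosed M := full_pred.

End FullSubmodule.

(* Ideals of R are submodules of the regular module R^o. *)
Section Ideals.
Variable R : comNzRingType.

Section Principal.
Variable a : R.
Definition pideal_pred : {pred R^o} := fun x => `[< exists c, x = c * a >].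
Lemma pideal_pred_closed : submod_closed pideal_pred.
Proof.
split; first by apply/asboolP; exists 0; rewrite mul0r.
move=> c _ _ /asboolP[x ->] /asboolP[y ->]; apply/asboolP.
by exists (c * x + y); rewrite mulrDl -mulrA.
Qed.
HB.instance Definition _ := GRing.isSubmodClosed.Build R R^o pideal_pred
  pideal_pred_closed.
Definition pideal : submodClosed R^o := pideal_pred.
End Principal.

Definition maximal_ideal (I : submodClosed R^o) : Prop :=
  (1 : R^o) \notin I /\
  forall J : submodClosed R^o,
    {subset I <= J} -> (1 : R^o) \notin J -> {subset J <= I}.

End Ideals.

(* A local principal ideal domain that is not a field. *)
Record is_dvr (R : idomainType) : Prop := {
  dvr_principal : forall I : submodClosed R^o, exists a, I =i pideal a;
  dvr_local : exists2 I : submodClosed R^o, maximal_ideal I &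
                forall J : submodClosed R^o, maximal_ideal J -> J =i I;
  dvr_not_field : exists2 x : R, x != 0 & x \isn't a GRing.unit
}.

Definition injective_module (R : pzRingType) (E : lmodType R) : Prop :=
  forall (M N : lmodType R) (i : {linear M -> N}) (f : {linear M -> E}),
    injective i -> exists g : {linear N -> E}, forall x, g (i x) = f x.

(* iota exhibits E as an injective envelope of K: E is injective and iota is an
   essential monomorphism. *)
Record injective_envelope (R : pzRingType) (K E : lmodType R)
    (iota : {linear K -> E}) : Prop := {
  envelope_injective : injective_module E;
  envelope_mono : injective iota;
  envelope_essential : forall N : submodClosed E,
    (forall x, iota x \in N -> iota x = 0) -> N =i pred1 0
}.

Section Types.
Variables (R : comNzRingType) (p : R).

Definition cyclic_mod (m : nat) : lmodType R := quotmod (pideal (p ^+ m)).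

Definition is_partition (l : seq nat) : bool :=
  sorted geq l && all (leq 1) l.

(* N_lambda; the empty sum is the zero module. *)
Fixpoint Nmod (l : seq nat) : lmodType R :=
  if l is m :: l' then (cyclic_mod m * Nmod l')%type else 'rV[R]_0.

Definition lmod_iso (M N : lmodType R) : Prop :=
  exists f : {linear M -> N}, bijective f.

Definition has_type (M : lmodType R) (l : seq nat) : Prop :=
  is_partition l /\ lmod_iso M (Nmod l).

(* The type of M; [::] by default when M has no type. *)
Definition mtype (M : lmodType R) : seq nat :=
  xget [::] [set l | has_type M l]%classic.

End Types.

Record embedding (R : pzRingType) := Embedding {
  ambient : lmodType R;
  emb_sub : submodClosed ambient
}.

Section Embeddings.
Variables (R : comNzRingType) (p : R).
Implicit Types X Y : embedding R.

Section HomS.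
Variables X Y : embedding R.
Definition homS_pred : {pred hom_mod (ambient X) (ambient Y)} :=
  fun f => `[< forall a, a \in emb_sub X -> hom_fun f a \in emb_sub Y >].
Lemma homS_pred_closed : submod_closed homS_pred.
Proof.
split; first by apply/asboolP => a _; exact: rpred0.
move=> c f g /asboolP fS /asboolP gS; apply/asboolP => a aX.
rewrite -[hom_fun _ a]/(c *: hom_fun f a + hom_fun g a).
by rewrite rpredD ?rpredZ ?fS ?gS.
Qed.
HB.instance Definition _ := GRing.isSubmodClosed.Build R
  (hom_mod (ambient X) (ambient Y)) homS_pred homS_pred_closed.
Definition homS : lmodType R := submod_of homS_pred.
End HomS.

Definition picket (m l : nat) : embedding R :=
  Embedding (soc p l (full_submod (cyclic_mod p m))).

Definition hom_matrix X (m l : nat) : nat := len (homS (picket m l) X).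

(* alpha_1, which is 0 when A = 0. *)
Definition alpha1 X : nat := head 0%N (mtype p (submod_of (emb_sub X))).

(* A tableau is encoded by its sequence of partitions (of length s + 1). *)
Definition socle_tableau X : seq (seq nat) :=
  mkseq (fun i => mtype p (quotmod (soc p i (emb_sub X)))) (alpha1 X).+1.

Definition LR_tableau X : seq (seq nat) :=
  mkseq (fun i => mtype p (quotmod (rad p i (emb_sub X)))) (alpha1 X).+1.

Section Dual.
Variables (E : lmodType R) (X : embedding R).
Let pi : {linear ambient X -> quotmod (emb_sub X)} := quot_proj (emb_sub X).

(* The image of Hom(pi, E) : DC -> DB. *)
Definition dual_pred : {pred hom_mod (ambient X) E} :=
  fun g => `[< exists h, g = hom_precomp pi h >].
Lemma dual_pred_closed : submod_closed dual_pred.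
Proof.
split.
  by apply/asboolP; exists 0; apply: val_inj; apply/funext.
move=> c _ _ /asboolP[f ->] /asboolP[g ->]; apply/asboolP.
by exists (c *: f + g); apply: val_inj; apply/funext.
Qed.
HB.instance Definition _ := GRing.isSubmodClosed.Build R
  (hom_mod (ambient X) E) dual_pred dual_pred_closed.
Definition dual_emb : embedding R := Embedding (dual_pred : submodClosed _).
End Dual.

End Embeddings.

(* Main.v *)
(* For an embedding X of A into B, all three invariants amount to the numbers
     w(m, i) = len {b in B | p^m b = 0, p^i b in A}.
   Evaluation at the generator identifies Hom(P^m_l, X) with the submodule for
   (m, m - l), and w(m, i) = w(m, m) for i >= m.  The p^k-torsion of B/soc^i A
   is the subquotient {b | p^k b in A, p^(k+i) b = 0} / soc^i A, of length
   w(k + i, k) - w(i, 0).  Finally, with C = B/A, the submodule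
   p^i DC + p^k DB of DB is the annihilator of {b | p^k b = 0, p^i b in A}
   (extend along the injection of the quotient into C + B), so that
   (DB/p^i DC)/p^k has length w(k, i).
   By the structure theorem a module M of finite length is determined by the
   lengths of the M/p^k M, or equivalently by those of its p^k-torsion. *)
From HB Require Import structures.
From mathcomp Require Import all_boot all_order all_algebra.
From mathcomp Require Import ring_quotient generic_quotient.
From mathcomp Require Import boolp classical_sets functions.
From mathcomp Require Import zify.
Require Import Defs.
Import GRing.Theory.
Local Open Scope ring_scope.
Set Implicit Arguments.
Unset Strict Implicit.
Unset Printing Implicit Defensive.

(** * Lengths of chains of submodules *)

(** The socle tableau does not show w(i, 0) directly: it gives only the differences w(k + i, k) -
    w(i, 0), for i up to alpha_1. If p^k kills B, the first term is the length of B, which the entry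
    i = 0 already determines; this isolates w(i, 0). Both kinds of tableaux stop at an alpha_1 that
    depends on the embedding, so alpha_1 itself has to be read off from w, and w must be shown to be
    stationary beyond it. The module E enters through two facts: maps into it extend, and its socle
    is a line over the residue field. Hence the annihilator of a simple step U < V is again a simple
    step, and annihilators turn composition series of M into composition series of Hom(M, E).
    Lengths are mostly handled as relative lengths between two submodules of one module, which
    avoids iterated quotients. *)

Section Submodules.
Variables (R : pzRingType) (M : lmodType R).
(** Leibniz equality, not only [=i], allows a submodule to be replaced inside [cover], [rlen] and
    [slen]. *)
Lemma submod_ext (U V : submodClosed M) : U =i V -> U = V.
Proof.
case: U V => [u [[u1] [u2]]] [v [[v1] [v2]]] h.
have e : u = v by apply: funext => x; exact: h x.
move: v1 v2 {h}; rewrite -e => v1 v2.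
by rewrite (Prop_irrelevance u1 v1) (Prop_irrelevance u2 v2).
Qed.

Section Psub.
Variable P : M -> Prop.
(** The closure proofs are arguments of the predicate itself, so that the closure instance can be
    inferred from the term alone. *)
Definition psub_pred of P 0 & (forall a x y, P x -> P y -> P (a *: x + y)) :
  {pred M} := fun x => `[< P x >].
Hypotheses (P0 : P 0) (PL : forall a x y, P x -> P y -> P (a *: x + y)).
Lemma psub_closed : submod_closed (psub_pred P0 PL).
Proof.
split; first exact/asboolP.
by move=> a x y /asboolP Px /asboolP Py; apply/asboolP; exact: PL.
Qed.
HB.instance Definition _ :=
  GRing.isSubmodClosed.Build R M (psub_pred P0 PL) psub_closed.
Definition psub : submodClosed M := psub_pred P0 PL.
Lemma psubE x : x \in psub <-> P x.
Proof. by split=> [/asboolP|?]; [|apply/asboolP]. Qed.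
End Psub.

Implicit Types U V W N : submodClosed M.

Lemma submodB U x y : x \in U -> y \in U -> x - y \in U.
Proof. by move=> xU yU; rewrite -scaleN1r rpredD ?rpredZ. Qed.

Lemma submod_antisym U V : {subset U <= V} -> {subset V <= U} -> U = V.
Proof.
by move=> UV VU; apply: submod_ext => x; apply/idP/idP; [exact: UV|exact: VU].
Qed.

Fact zero_submod0 : (0 : M) = 0. Proof. by []. Qed.
Fact zero_submodL (a : R) (x y : M) : x = 0 -> y = 0 -> a *: x + y = 0.
Proof. by move=> -> ->; rewrite scaler0 addr0. Qed.
Definition zero_submod : submodClosed M := psub zero_submod0 zero_submodL.

Lemma zero_submodE x : x \in zero_submod <-> x = 0.
Proof. exact: psubE. Qed.

Lemma zero_submod_sub U : {subset zero_submod <= U}.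
Proof. by move=> x /zero_submodE ->; exact: rpred0. Qed.

Fact cap0 U V : 0 \in U /\ 0 \in V. Proof. by rewrite !rpred0. Qed.
Fact capL U V (a : R) x y : x \in U /\ x \in V -> y \in U /\ y \in V ->
  a *: x + y \in U /\ a *: x + y \in V.
Proof. by move=> [xU xV] [yU yV]; split; apply: rpredD => //; exact: rpredZ. Qed.
Definition cap_submod U V : submodClosed M := psub (cap0 U V) (@capL U V).

Lemma capE U V x : x \in cap_submod U V <-> x \in U /\ x \in V.
Proof. exact: psubE. Qed.

Fact sum0 U V : exists2 u, u \in U & 0 - u \in V.
Proof. by exists 0; rewrite ?subr0 rpred0. Qed.
Fact sumL U V (a : R) x y : (exists2 u, u \in U & x - u \in V) ->
  (exists2 u, u \in U & y - u \in V) -> exists2 u, u \in U & a *: x + y - u \in V.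
Proof.
move=> [u uU xV] [v vU yV]; exists (a *: u + v); first by rewrite rpredD ?rpredZ.
by rewrite opprD addrACA -scalerBr rpredD ?rpredZ.
Qed.
Definition sum_submod U V : submodClosed M := psub (sum0 U V) (@sumL U V).

Lemma sumE U V x : x \in sum_submod U V <-> exists2 u, u \in U & x - u \in V.
Proof. exact: psubE. Qed.

Lemma sum_subl U V : {subset U <= sum_submod U V}.
Proof. by move=> x xU; apply/sumE; exists x; rewrite ?subrr ?rpred0. Qed.

Lemma sum_subr U V : {subset V <= sum_submod U V}.
Proof. by move=> x xU; apply/sumE; exists 0; rewrite ?subr0 ?rpred0. Qed.

Lemma sum_sub U V W : {subset U <= W} -> {subset V <= W} -> {subset sum_submod U V <= W}.
Proof. by move=> UW VW x /sumE[u /UW uW /VW vW]; rewrite -(subrK u x) rpredD. Qed.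

(** Equivalently, [V / U] is a simple module. *)
Definition cover U V : Prop :=
  [/\ {subset U <= V}, ~ {subset V <= U} &
      forall N, {subset U <= N} -> {subset N <= V} -> N = U \/ N = V].

(** A composition series of [V / U], expressed without forming the quotient. As a relation it makes
    sense before lengths are known to be finite or unique. *)
Inductive rlen U : submodClosed M -> nat -> Prop :=
| rlen0 : rlen U U 0
| rlenS V W n of rlen U V n & cover V W : rlen U W n.+1.

Lemma rlen_sub U V n : rlen U V n -> {subset U <= V}.
Proof. by elim=> // {}V W {}n _ IH [VW _ _] x /IH/VW. Qed.

Lemma rlen_trans U V W m n : rlen U V m -> rlen V W n -> rlen U W (m + n).
Proof.
move=> UV; elim=> [|W' W'' k _ IH WW]; first by rewrite addn0.
by rewrite addnS; exact: rlenS WW.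
Qed.

Lemma cover_rlen U V : cover U V -> rlen U V 1.
Proof. by move=> UV; exact: rlenS (rlen0 U) UV. Qed.

Lemma rlen0_eq U V n : rlen U V n -> n = 0%N -> U = V.
Proof. by case. Qed.

Lemma rlen_eq0 U V n : rlen U V n -> {subset V <= U} -> n = 0%N.
Proof. by case=> // {}V W {}n /rlen_sub UV [_ nWV _] WU; case: nWV => x /WU/UV. Qed.

Lemma cover_rlen_inv U V n : cover U V -> rlen U V n -> n = 1%N.
Proof.
move=> cUV h; case: h cUV => [[_ []//]|W X m UW WX [_ nXU /(_ W)]].
case=> [||eW|eW]; first exact: rlen_sub UW; first by case: WX.
- by rewrite (rlen_eq0 UW) // eW.
- by case: WX => _ []; rewrite eW.
Qed.

Lemma has_lengthE n : has_length M n <-> rlen zero_submod (full_submod M) n.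
Proof.
split=> [[c [c0 cn cc]]|].
  have {cn}<- : c n = full_submod M by exact: submod_ext.
  have {c0}<- : c 0%N = zero_submod.
    apply: submod_ext => x; rewrite c0; apply/idP/idP => [/eqP->|/zero_submodE->].
      exact: rpred0.
    by rewrite inE eqxx.
  elim: n cc => [_|n IH cc]; first exact: rlen0.
  apply: rlenS (IH _) _ => [i lin|]; first by apply: cc; rewrite ltnS ltnW.
  have [s ns h] := cc n (ltnSn n); split=> // N Nl Nr.
  by case: (h N Nl Nr) => e; [left|right]; exact: submod_ext.
move=> h.
suff [c [c0 cn cc]]: exists c : nat -> submodClosed M, [/\ c 0%N = zero_submod,
    c n = full_submod M & forall i, (i < n)%N -> cover (c i) (c i.+1)].
  exists c; split=> [x|x|i /cc[s ns hN]]; last split=> // N Nl Nr.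
  - by rewrite c0 inE; apply/idP/eqP => [/zero_submodE|->]; rewrite ?rpred0.
  - by rewrite cn.
  - by case: (hN N Nl Nr) => ->; [left|right].
elim: h => [|V W k _ [c [c0 cn cc]] VW]; first by exists (fun=> zero_submod).
exists (fun i => if (i <= k)%N then c i else W); rewrite ltnn; split=> // i.
move=> lin; have [->|nik] := eqVneq i k; first by rewrite leqnn ltnn cn.
have ik : (i < k)%N by rewrite ltn_neqAle nik.
by rewrite (ltnW ik) ik; exact: cc.
Qed.

(** By simplicity [N + U = V], so [N / (N cap U)] is isomorphic to [V / U]. A module [K] in between
    is recovered from [K + U] by the modular law. *)
Lemma cover_cap U V N : cover U V -> {subset N <= V} -> ~ {subset N <= U} ->
  cover (cap_submod N U) N.
Proof.
move=> [UV _ h] NV NU; split=> [x /capE[]//|NNU|K KN].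
  by apply: NU => x /NNU /capE[].
move=> KN'; case: (h (sum_submod K U)).
- exact: sum_subr.
- by apply: sum_sub => // x /KN'/NV.
- move=> e; left; apply: submod_antisym => [x xK|//]; apply/capE; split; first exact: KN'.
  by rewrite -e; exact: sum_subl.
- move=> e; right; apply: submod_antisym => [//|x xN].
  have /sumE[y yK xyU] : x \in sum_submod K U by rewrite e NV.
  rewrite -(subrK y x); apply: rpredD => //; apply: KN; apply/capE; split=> //.
  by apply: submodB => //; exact: KN'.
Qed.

End Submodules.

(** * Transport of lengths along isomorphisms of subquotients *)

Section Transport.
Variables (R : pzRingType) (M M' : lmodType R) (f : {linear M -> M'}).

Section Push.
Variables (A : submodClosed M) (U' : submodClosed M').

Fact push0 : exists2 x, x \in A & 0 - f x \in U'.
Proof. by exists 0; [exact: rpred0 | rewrite raddf0 subr0; exact: rpred0]. Qed.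
Fact pushL (a : R) y z : (exists2 x, x \in A & y - f x \in U') ->
  (exists2 x, x \in A & z - f x \in U') ->
  exists2 x, x \in A & a *: y + z - f x \in U'.
Proof.
move=> [u uU xV] [v vU yV]; exists (a *: u + v); first by rewrite rpredD ?rpredZ.
by rewrite linearP opprD addrACA -scalerBr rpredD ?rpredZ.
Qed.
Definition push_submod : submodClosed M' := psub push0 pushL.
Lemma pushE y : y \in push_submod <-> exists2 x, x \in A & y - f x \in U'.
Proof. exact: psubE. Qed.
Lemma push_f x : x \in A -> f x \in push_submod.
Proof. by move=> xA; apply/pushE; exists x; rewrite ?subrr ?rpred0. Qed.
Lemma push_sub : {subset U' <= push_submod}.
Proof. by move=> y yU; apply/pushE; exists 0; [exact: rpred0 | rewrite raddf0 subr0]. Qed.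
End Push.

Section Pull.
Variables (V : submodClosed M) (A' : submodClosed M').
Fact pull0 : 0 \in V /\ f 0 \in A'.
Proof. by rewrite raddf0 !rpred0. Qed.
Fact pullL (a : R) y z : y \in V /\ f y \in A' -> z \in V /\ f z \in A' ->
  a *: y + z \in V /\ f (a *: y + z) \in A'.
Proof. by move=> [? ?] [? ?]; rewrite linearP; split; rewrite rpredD ?rpredZ. Qed.
Definition pull_submod : submodClosed M := psub pull0 pullL.
Lemma pullE x : x \in pull_submod <-> x \in V /\ f x \in A'.
Proof. exact: psubE. Qed.
End Pull.

(* [f] induces an isomorphism from V / U onto V' / U'. *)
Record subquo_iso (U V : submodClosed M) (U' V' : submodClosed M') : Prop := {
  subquo_sub : {subset U <= V};
  subquo_sub' : {subset U' <= V'};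
  subquo_img : forall x, x \in V -> f x \in V';
  subquo_inj : forall x, x \in V -> (f x \in U' <-> x \in U);
  subquo_surj : forall y, y \in V' -> exists2 x, x \in V & y - f x \in U'
}.

(** Each term [X] of the series becomes [f(X) + U']. A module between two consecutive images is
    pulled back to the source, where simplicity applies. *)
Lemma rlen_push U V U' V' n :
  subquo_iso U V U' V' -> rlen U V n -> rlen U' V' n.
Proof.
case=> _ UV' fV inj surj h.
have -> : V' = push_submod V U'.
  apply: submod_antisym => y; first by move=> /surj ?; apply/pushE.
  by move=> /pushE[x /fV fx]; move/UV' => yx; rewrite -(subrK (f x) y) rpredD.
move: inj {surj fV UV' V'}; elim: h => [|{}V W m UV IH [VW WV c] inj].
  move=> inj; suff -> : push_submod U U' = U' by exact: rlen0.
  apply: submod_antisym => y; last exact: push_sub.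
  by move=> /pushE[x xU yx]; rewrite -(subrK (f x) y) rpredD //; apply/inj.
apply: rlenS (IH _) _ => [x /VW|]; first exact: inj.
have injV x : x \in W -> f x \in push_submod V U' -> x \in V.
  move=> xW /pushE[z zV]; rewrite -linearB => /inj h.
  by rewrite -(subrK z x) rpredD // (rlen_sub UV) // h // submodB // VW.
split=> [y /pushE[x xV yx]|s|N' VN' NW']; first by apply/pushE; exists x; rewrite ?VW.
  by apply: WV => x xW; apply: injV => //; apply/s/push_f.
have [|x /pullE[]//|e|e] := c (pull_submod W N').
- by move=> x xV; apply/pullE; split; [exact: VW|exact/VN'/push_f].
- left; apply: submod_antisym => // y yN; have /pushE[x xW yx] := NW' _ yN.
  apply/pushE; exists x => //; rewrite -e; apply/pullE; split=> //.
  rewrite -(subKr y (f x)); apply: submodB => //; exact/VN'/push_sub.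
- right; apply: submod_antisym => // y /pushE[x]; rewrite -{1}e => /pullE[_ fx] yx.
  by rewrite -(subrK (f x) y) rpredD //; exact/VN'/push_sub.
Qed.

(** Only the induced map of subquotients is invertible, not [f], so [rlen_push] cannot be applied to
    an inverse. Terms are pulled back into [V], and simplicity is tested on images. *)
Lemma rlen_pull U V U' V' n :
  subquo_iso U V U' V' -> rlen U' V' n -> rlen U V n.
Proof.
case=> UV UV' fV inj surj h.
have -> : V = pull_submod V V'.
  by apply: submod_antisym => x; [move=> xV; apply/pullE; split=> //; exact: fV|move=> /pullE[]].
suff main W m : rlen U' W m -> {subset W <= V'} -> rlen U (pull_submod V W) m by exact: main.
move=> {h n} h; elim: h => [_|X {}W {}m UX IH [XW WX c] WV'].
  suff -> : pull_submod V U' = U by exact: rlen0.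
  apply: submod_antisym => x; first by move=> /pullE[xV /(inj x xV)].
  by move=> xU; apply/pullE; split; [exact: UV|apply/inj => //; exact: UV].
apply: rlenS (IH _) _ => [x /XW/WV' //|].
split=> [x /pullE[xV fx]|s|N XN NW]; first by apply/pullE; split=> //; exact: XW.
  apply: WX => y yW; have [x xV yx] := surj y (WV' y yW).
  have yx' : y - f x \in X by exact: rlen_sub UX _ yx.
  rewrite -(subrK (f x) y) rpredD //.
  suff /s/pullE[] : x \in pull_submod V W by [].
  by apply/pullE; split=> //; rewrite -(subKr y (f x)) submodB // XW.
have NV x : x \in N -> x \in V by move=> /NW/pullE[].
have [y yX|y /pushE[x xN yx]|e|e] := c (push_submod N U').
- have [x xV yx] := surj y (WV' y (XW y yX)).
  apply/pushE; exists x => //; apply: XN; apply/pullE; split=> //.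
  by rewrite -(subKr y (f x)) submodB //; exact: rlen_sub UX _ yx.
- rewrite -(subrK (f x) y) rpredD //; first by apply/XW/(rlen_sub UX).
  by have /pullE[] := NW x xN.
- left; apply: submod_antisym => // x xN; apply/pullE; split; first exact: NV.
  by rewrite -e; exact: push_f.
- right; apply: submod_antisym => // x /pullE[xV]; rewrite -e => /pushE[z zN].
  rewrite -linearB => /inj; rewrite submodB ?(NV z) // => /(_ isT) xz.
  rewrite -(subrK z x) rpredD //; apply: XN; apply/pullE; split; first exact: UV.
  by apply: (rlen_sub UX); apply/inj => //; exact: UV.
Qed.

End Transport.

(** * Additivity and uniqueness of length (Jordan-Hoelder) *)

Section Length.
Variables (R : pzRingType) (M : lmodType R).
Implicit Types U V W N : submodClosed M.

(** Intersect [N] with the last proper term of the series. If [N] lies below that term, the top step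
    goes to the upper part; otherwise it reappears in the lower part, just below [N]. *)
Lemma rlen_split U V N n : rlen U V n -> {subset U <= N} -> {subset N <= V} ->
  exists a b, [/\ rlen U N a, rlen N V b & (a + b)%N = n].
Proof.
move=> h; elim: h N => [N UN NU|{}V W m UV IH cVW N UN NW].
  have -> : N = U by exact: submod_antisym.
  by exists 0%N, 0%N; split; try exact: rlen0.
have [VW WV c] := cVW.
have [|x /capE[]//|a [b [ha hb e]]] := IH (cap_submod N V).
  by move=> x xU; apply/capE; split; [exact: UN|exact: (rlen_sub UV)].
have [NV|NV] := pselect {subset N <= V}.
  have eN : cap_submod N V = N.
    by apply: submod_antisym => [x /capE[]//|x xN]; apply/capE; split=> //; exact: NV.
  exists a, b.+1; rewrite addnS e; split; [by rewrite -eN| |by []]; rewrite eN in hb.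
  by apply: rlenS cVW.
have cN : cover (cap_submod N V) N by exact: cover_cap cVW _ _.
exists a.+1, b; rewrite addSn e; split=> //; first exact: rlenS cN.
(* Here [N + V = W], and the second isomorphism theorem carries the series of [V / (N cap V)] to
   [W / N]. *)
apply: (@rlen_push _ _ _ idfun (cap_submod N V) V) hb.
split=> //= [x /capE[]//|x xV|y yW].
  by split=> [xN|/capE[]//]; apply/capE.
have [x xV|x|e1|e1] := c (sum_submod N V).
- exact: sum_subr.
- by apply: sum_sub.
- by case: NV => x xN; rewrite -e1; exact: sum_subl.
- move: yW; rewrite -e1 => /sumE[u uN yuV]; exists (y - u) => //.
  by rewrite subKr.
Qed.

(** One series is split at the last proper term of the other; a simple quotient only admits series
    with one step. *)
Lemma rlen_inj U V m n : rlen U V m -> rlen U V n -> m = n.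
Proof.
move=> h h'; elim: h' m h => [m h|X {}V {}n UX IH XV m h].
  exact: rlen_eq0 h _.
have [XV' _ _] := XV.
have [a [b [/IH -> /(cover_rlen_inv XV) -> <-]]] := rlen_split h (rlen_sub UX) XV'.
by rewrite addn1.
Qed.

(** Measured inside [M], so that submodules of one module are compared directly; 0 is the default
    when [U] has no finite length. *)
Definition slen U : nat := xget 0%N [set n | rlen (zero_submod M) U n]%classic.

Lemma slenP U n : rlen (zero_submod M) U n -> slen U = n.
Proof.
move=> h; apply: (rlen_inj _ h); pose S := [set k | rlen (zero_submod M) U k]%classic.
by apply: (@xgetPex _ 0%N S); exists n.
Qed.

Lemma lenP n : rlen (zero_submod M) (full_submod M) n -> len M = n.
Proof.
move=> h; apply: (rlen_inj _ h); apply/has_lengthE.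
by apply: (@xgetPex _ 0%N [set k | has_length M k]%classic); exists n; apply/has_lengthE.
Qed.

Lemma slen0 : slen (zero_submod M) = 0%N.
Proof. exact/slenP/rlen0. Qed.

Hypothesis fM : finite_length M.

Lemma slen_rlen U : rlen (zero_submod M) U (slen U).
Proof.
have [n /has_lengthE h] := fM.
have [//|a [b [ha _ _]]] := rlen_split h (@zero_submod_sub _ _ U).
by apply: (@xgetPex _ 0%N [set k | rlen (zero_submod M) U k]%classic); exists a.
Qed.

Lemma rlen_slen U V : {subset U <= V} ->
  exists2 n, rlen U V n & slen V = (slen U + n)%N.
Proof.
move=> UV; have [a [b [ha hb e]]] := rlen_split (slen_rlen V) (@zero_submod_sub _ _ U) UV.
by exists b => //; rewrite (slenP ha).
Qed.

Lemma leq_slen U V : {subset U <= V} -> (slen U <= slen V)%N.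
Proof. by move=> /rlen_slen[n _ ->]; exact: leq_addr. Qed.

Lemma slen_eq U V : {subset U <= V} -> slen U = slen V -> U = V.
Proof.
move=> /rlen_slen[n h ->]; rewrite -{1}[slen U]addn0 => /addnI e.
exact: rlen0_eq h (esym e).
Qed.

End Length.

(** * Quotients and discrete valuation rings *)

Section Quotient.
Variables (R : pzRingType).

Definition mk_linear (M M' : lmodType R) (f : M -> M') (fl : linear f) :
  {linear M -> M'} := HB.pack f (GRing.isLinear.Build R M M' *:%R f fl).

Variables (M : lmodType R) (N : submodClosed M).

Lemma quot_proj_eq x y : quot_proj N x = quot_proj N y <-> x - y \in N.
Proof.
have -> : (x - y \in N) = (x - y \in zmod_pred N) by [].
rewrite Quotient.idealrBE; split=> [e|/eqP //].
exact/eqP.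
Qed.

Lemma quot_proj_eq0 x : quot_proj N x = 0 <-> x \in N.
Proof. by rewrite -(raddf0 (quot_proj N)) quot_proj_eq subr0. Qed.

Lemma quot_proj_surj q : exists x, q = quot_proj N x.
Proof. by exists (repr q); rewrite /quot_proj reprK. Qed.

Lemma quot_lift (M' : lmodType R) (f : {linear M -> M'}) :
  (forall x, x \in N -> f x = 0) ->
  exists g : {linear quotmod N -> M'}, forall x, g (quot_proj N x) = f x.
Proof.
move=> f0; pose g (q : quotmod N) := f (repr q).
have gE x : g (quot_proj N x) = f x.
  apply: subr0_eq; rewrite /g -linearB; apply: f0; apply/quot_proj_eq.
  by rewrite /quot_proj reprK.
have gl : linear g.
  move=> a q q'; have [x ->] := quot_proj_surj q; have [y ->] := quot_proj_surj q'.
  by rewrite -linearP !gE linearP.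
by exists (mk_linear gl) => x; exact: gE.
Qed.

End Quotient.

Section SubquoIso.
Variables (R : pzRingType) (M M' : lmodType R) (f : {linear M -> M'}).

Lemma surj_subquo (U V : submodClosed M) (U' V' : submodClosed M') :
  (forall y, exists x, y = f x) -> {subset U <= V} ->
  (forall x, f x \in U' <-> x \in U) -> (forall x, f x \in V' <-> x \in V) ->
  subquo_iso f U V U' V'.
Proof.
move=> surj UV hU hV; split=> // [y|x /hV//|y].
  by have [x ->] := surj y; move=> /hU/UV/hV.
by have [x ->] := surj y; move=> /hV xV; exists x; rewrite // subrr rpred0.
Qed.

Lemma inj_subquo (W : submodClosed M') : injective f ->
  (forall y, y \in W <-> exists x, y = f x) ->
  subquo_iso f (zero_submod M) (full_submod M) (zero_submod M') W.
Proof.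
move=> finj fW; split=> // [|x _|x _|y /fW[x ->]]; first exact: zero_submod_sub.
- by apply/fW; exists x.
- split=> /zero_submodE; last by move=> ->; rewrite raddf0 rpred0.
  by rewrite -(raddf0 f) => /finj ->; exact: rpred0.
- by exists x; rewrite // subrr rpred0.
Qed.

End SubquoIso.

Lemma submod_of_subquo (R : pzRingType) (M : lmodType R) (N : submodClosed M) :
  subquo_iso (val : {linear submod_of N -> M}) (zero_submod _) (full_submod _)
    (zero_submod M) N.
Proof.
apply: inj_subquo => [|y]; first exact: val_inj.
by split=> [yN|[x ->]]; [exists (SubmodOf yN)|exact: valP].
Qed.

Section Dvr.
Variables (R : idomainType) (p : R).
Hypotheses (dvr : is_dvr R) (pmax : maximal_ideal (pideal p)).

Lemma pidealE (a x : R) : (x : R^o) \in pideal a <-> exists c, x = c * a.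
Proof. by split=> [/asboolP|?]; [|apply/asboolP]. Qed.

Lemma dvr_neq1 c : c * p <> 1.
Proof. by case: pmax => n1 _ e; move/negP: n1; case; apply/pidealE; exists c. Qed.

(** [is_dvr] gives a unique maximal ideal, but not that it contains every proper ideal; Zorn's lemma
    does. *)
Lemma proper_in_maximal (I : submodClosed R^o) : (1 : R^o) \notin I ->
  exists2 J : submodClosed R^o, maximal_ideal J & {subset I <= J}.
Proof.
move=> I1; pose T := {J : submodClosed R^o | (1 : R^o) \notin J /\ {subset I <= J}}.
pose le (J K : T) := `[< {subset sval J <= sval K} >].
have [||A tot|[J [J1 IJ]] /= Jmax] := @ZL_preorder T (exist _ I (conj I1 (fun _ h => h))) le.
- by move=> J; apply/asboolP.
- by move=> J K L /asboolP h /asboolP h'; apply/asboolP => x /h/h'.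
(* The union of the chain, joined with [I] so that the empty chain is bounded too. *)
- pose P (x : R^o) := x \in I \/ exists2 J, A J & x \in sval J.
  have P0 : P 0 by left; exact: rpred0.
  have PL (a : R) x y : P x -> P y -> P (a *: x + y).
    move=> [xI|[J AJ xJ]] [yI|[K AK yK]].
    - by left; rewrite rpredD ?rpredZ.
    - by right; exists K; rewrite // rpredD ?rpredZ //; exact: (proj2 (svalP K)).
    - by right; exists J; rewrite // rpredD ?rpredZ //; exact: (proj2 (svalP J)).
    - have [/asboolP JK|/asboolP KJ] := tot J K AJ AK.
        by right; exists K; rewrite // rpredD ?rpredZ //; exact: JK.
      by right; exists J; rewrite // rpredD ?rpredZ //; exact: KJ.
  have S1 : (1 : R^o) \notin psub P0 PL /\ {subset I <= psub P0 PL}.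
    split; last by move=> x xI; apply/psubE; left.
    apply/negP => /psubE[|[J AJ]]; first exact/negP.
    by apply/negP; case: (svalP J).
  exists (exist _ (psub P0 PL) S1) => J AJ; apply/asboolP => x xJ /=.
  by apply/psubE; right; exists J.
- exists J => //; split=> // K JK K1.
  have h : (1 : R^o) \notin K /\ {subset I <= K} by split=> // x /IJ/JK.
  by have /asboolP := Jmax (exist _ K h) (asboolT JK).
Qed.

(** A non-unit generates a proper ideal, which lies in a maximal ideal, that is, in [(p)]. *)
Lemma dvr_unit (a : R) : ~ (exists c, a = c * p) -> a \is a GRing.unit.
Proof.
move=> ap; have [//|au] := boolP (a \is a GRing.unit).
have [|J Jmax aJ] := @proper_in_maximal (pideal a).
  apply/negP => /pidealE[c e]; move/negP: au; case.
  by apply/unitrPr; exists c; rewrite mulrC.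
have [I0 _ h] := dvr_local dvr.
case: ap; apply/pidealE; rewrite (h _ pmax) -(h _ Jmax); apply: aJ.
by apply/pidealE; exists 1; rewrite mul1r.
Qed.

Lemma dvr_neq0 : p != 0.
Proof.
apply/eqP => p0; have [x x0 /negP] := dvr_not_field dvr; case; apply: dvr_unit.
by move=> [c]; rewrite p0 mulr0 => /eqP; exact/negP.
Qed.

End Dvr.

Section Line.
Variables (R : pzRingType) (M : lmodType R) (x : M).

Fact line0 : exists c, 0 = c *: x.
Proof. by exists 0; rewrite scale0r. Qed.
Fact lineL (a : R) y z : (exists c, y = c *: x) -> (exists c, z = c *: x) ->
  exists c, a *: y + z = c *: x.
Proof. by move=> [c ->] [d ->]; exists (a * c + d); rewrite scalerDl scalerA. Qed.
Definition line_submod : submodClosed M := psub line0 lineL.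
Lemma lineE y : y \in line_submod <-> exists c, y = c *: x.
Proof. exact: psubE. Qed.
Lemma line_id : x \in line_submod.
Proof. by apply/lineE; exists 1; rewrite scale1r. Qed.

Lemma cover_gen (U V : submodClosed M) : cover U V -> x \in V -> x \notin U ->
  forall v, v \in V -> exists c, v - c *: x \in U.
Proof.
move=> [UV _ h] xV /negP xU v vV; have [|||e] := h (sum_submod U line_submod).
- exact: sum_subl.
- by apply: sum_sub => // y /lineE[c ->]; exact: rpredZ.
- by move=> e; case: xU; rewrite -e; exact/sum_subr/line_id.
- move: vV; rewrite -e => /sumE[u uU /lineE[c e']]; exists c.
  by rewrite -e' subKr.
Qed.

End Line.

Section Cover.
Variables (R : idomainType) (p : R).
Hypotheses (dvr : is_dvr R) (pmax : maximal_ideal (pideal p)).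
Variable M : lmodType R.
Implicit Types U V W N : submodClosed M.

Lemma radE k (A : submodClosed M) x :
  x \in rad p k A <-> exists2 a, a \in A & x = p ^+ k *: a.
Proof. by split=> [/asboolP|?]; [|apply/asboolP]. Qed.

Lemma rad_fullE k (x : M) :
  x \in rad p k (full_submod M) <-> exists a, x = p ^+ k *: a.
Proof. by rewrite radE; split=> [[a _ ->]|[a ->]]; exists a. Qed.

Lemma socE k (A : submodClosed M) x :
  x \in soc p k A <-> x \in A /\ p ^+ k *: x = 0.
Proof. by split=> [/andP[? /eqP]|[h e]] //; apply/andP; split=> //; apply/eqP. Qed.

(** Nakayama's argument in [V / U]: a nonzero [p x] would generate [x], so [(1 - c p) x = 0] with
    [1 - c p] a unit. *)
Lemma cover_p U V : cover U V -> forall x, x \in V -> p *: x \in U.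
Proof.
move=> cUV x xV; apply: contrapT => /negP pxU.
have pxV : p *: x \in V by exact: rpredZ.
have [c] := cover_gen cUV pxV pxU xV; rewrite scalerA -{1}[x]scale1r -scalerBl => h.
have u : 1 - c * p \is a GRing.unit.
  apply: (dvr_unit dvr pmax) => -[d e]; apply: (dvr_neq1 pmax (c := c + d)).
  by rewrite mulrDl -e addrC subrK.
have xU : x \in U by rewrite -[x]scale1r -(mulVr u) -scalerA rpredZ.
by move/negP: pxU; case; exact: rpredZ.
Qed.

(** The conditions make [V / U] a nonzero cyclic module over the field [R / (p)]: an element of [N]
    outside [U] is a unit multiple of [x] modulo [U]. *)
Lemma cover_intro U V x : {subset U <= V} -> x \in V -> x \notin U ->
  p *: x \in U -> (forall v, v \in V -> exists c, v - c *: x \in U) -> cover U V.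
Proof.
move=> UV xV xU pxU gen; split=> // [/(_ x xV)|N UN NV]; first exact/negP.
have [NU|] := pselect {subset N <= U}; first by left; exact: submod_antisym.
move=> /existsNP[y /not_implyP[yN /negP yU]]; right; apply: submod_antisym => //.
have [c yc] := gen y (NV _ yN).
have cu : c \is a GRing.unit.
  apply: (dvr_unit dvr pmax) => -[d e]; case/negP: yU.
  by rewrite -(subrK (c *: x) y) rpredD // e -scalerA rpredZ.
have xN : x \in N.
  rewrite -[x]scale1r -(mulVr cu) -scalerA rpredZ //.
  by rewrite -(subKr y (c *: x)) submodB // UN.
by move=> v /gen[d vd]; rewrite -(subrK (d *: x) v) rpredD ?rpredZ // UN.
Qed.

Lemma rlen_kill U V n : rlen U V n -> forall x, x \in V -> p ^+ n *: x \in U.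
Proof.
elim=> [x xU|{}V W k _ IH VW x xW]; first by rewrite expr0 scale1r.
by rewrite exprSr -scalerA; apply/IH/(cover_p VW).
Qed.

Lemma finite_length_kill : finite_length M -> exists n, forall x : M, p ^+ n *: x = 0.
Proof.
move=> [n /has_lengthE/rlen_kill h]; exists n => x.
by apply/zero_submodE/h.
Qed.

(** Factors [p] are split off one at a time: if [r = c p^j] with [j <= m] and [p] did not divide
    [c], then [c] would be a unit and [p^j x = 0]. *)
Lemma ann_order m (x : M) (r : R) :
  p ^+ m *: x != 0 -> r *: x = 0 -> exists c, r = c * p ^+ m.+1.
Proof.
move=> px rx; suff h j : (j <= m.+1)%N -> exists c, r = c * p ^+ j by exact: h.
elim: j => [_|j IH jm]; first by exists r; rewrite expr0 mulr1.
have [c e] := IH (ltnW jm).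
suff [d ed] : exists d, c = d * p by exists d; rewrite e ed -mulrA -exprS.
apply: contrapT => /(dvr_unit dvr pmax) cu; case/eqP: px.
have pj : p ^+ j *: x = 0.
  have cpj : c *: (p ^+ j *: x) = 0 by rewrite scalerA -e.
  by rewrite -[LHS]scale1r -(mulVr cu) -scalerA cpj scaler0.
by rewrite -(subnK (jm : (j <= m)%N)) exprD -scalerA pj scaler0.
Qed.

End Cover.

(** The first differences in [k] count the parts exceeding [k] (the conjugate partition); the second
    differences are, up to sign, the multiplicities of the parts. *)
Lemma sum_minn_inj (s t : seq nat) : is_partition s -> is_partition t ->
  (forall k, sumn [seq minn j k | j <- s] = sumn [seq minn j k | j <- t]) -> s = t.
Proof.
move=> /andP[ss s1] /andP[ts t1] h.
have count_lt u k : sumn [seq minn j k.+1 | j <- u] =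
    (sumn [seq minn j k | j <- u] + count (fun j => k < j)%N u)%N.
  by elim: u => //= j u ->; rewrite addnACA; congr (_ + _)%N; case: (ltngtP k j); lia.
have count_eq u k : (count_mem k.+1 u + count (fun j => k.+1 < j) u =
    count (fun j => k < j) u)%N.
  by elim: u => //= j u <-; rewrite addnACA; congr (_ + _)%N; case: (ltngtP k.+1 j); lia.
have hc k : count (fun j => k < j)%N s = count (fun j => k < j)%N t.
  by have := count_lt s k; rewrite h count_lt h => /addnI ->.
apply: (@sorted_eq _ geq) => //.
- by move=> y x z xy yz; exact: leq_trans yz xy.
- by move=> x y; rewrite andbC /geq /= => /anti_leq.
apply/allP => -[|k] kst /=.
  have h0 u : all (leq 1) u -> count_mem 0%N u = 0%N.
    by elim: u => //= j u IH /andP[/lt0n_neq0/negPf-> /IH].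
  by rewrite !h0.
by apply/eqP; have := count_eq s k; rewrite !hc -(count_eq t k) => /addIn.
Qed.

(** * Modules of finite length over a discrete valuation ring *)

Lemma inj_surj_bijective (A B : Type) (f : A -> B) :
  injective f -> (forall y, exists x, y = f x) -> bijective f.
Proof.
by move=> finj /choice[g fg]; exists g => // x; apply: finj; rewrite -fg.
Qed.

Lemma lmod_iso_sym (R : pzRingType) (M M' : lmodType R) (f : {linear M' -> M}) :
  bijective f -> exists g : {linear M -> M'}, cancel f g /\ cancel g f.
Proof. by move=> [g fg gf]; exists (mk_linear (can2_linear fg gf)). Qed.

Section Structure.
Variables (R : idomainType) (p : R).
Hypotheses (dvr : is_dvr R) (pmax : maximal_ideal (pideal p)).

Lemma pexp_dvd i m : (exists c, p ^+ i = c * p ^+ m) <-> (m <= i)%N.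
Proof.
split=> [[c e]|mi]; last by exists (p ^+ (i - m)); rewrite -exprD subnK.
rewrite leqNgt; apply/negP => im; apply: (dvr_neq1 pmax (c := c * p ^+ (m - i.+1))).
apply: (mulIf (expf_neq0 i (dvr_neq0 dvr pmax))).
by rewrite mul1r {2}e -!mulrA -!exprS -exprD subnK.
Qed.

Lemma cyclic_kill m i : (forall z : cyclic_mod p m, p ^+ i *: z = 0) <-> (m <= i)%N.
Proof.
rewrite -pexp_dvd; split=> [/(_ (quot_proj _ (1 : R^o)))|[c e] z].
  by rewrite -linearZ => /quot_proj_eq0/pidealE[c]; rewrite -[_ *: _]/(_ * 1) mulr1; exists c.
have [x ->] := quot_proj_surj z; rewrite -linearZ; apply/quot_proj_eq0/pidealE.
by exists (c * x); rewrite -[_ *: _]/(_ * _) e mulrAC.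
Qed.

Lemma Nmod_kill s i : (forall z : Nmod p s, p ^+ i *: z = 0) <-> all (fun m => m <= i)%N s.
Proof.
elim: s => [|m s IH] /=; first by split=> // _ z; rewrite thinmx0.
split=> [h|/andP[/cyclic_kill hm /IH hs] [x y]]; last first.
  by apply/pair_equal_spec; split; [exact: hm|exact: hs].
apply/andP; split.
  by apply/cyclic_kill => x; exact: (congr1 fst (h (x, 0))).
by apply/IH => y; exact: (congr1 snd (h (0, y))).
Qed.

Lemma rlen_pideal n : rlen (pideal (p ^+ n)) (full_submod R^o) n.
Proof.
elim: n => [|n IH].
  suff -> : pideal (p ^+ 0) = full_submod R^o by exact: rlen0.
  by apply: submod_antisym => // x _; apply/pidealE; exists x; rewrite mulr1.
rewrite -add1n; apply: rlen_trans IH; apply: cover_rlen.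
apply: (cover_intro dvr pmax (x := (p ^+ n : R^o))).
- by move=> x /pidealE[c ->]; apply/pidealE; exists (c * p); rewrite -mulrA -exprS.
- by apply/pidealE; exists 1; rewrite mul1r.
- by apply/negP => /pidealE/pexp_dvd; rewrite ltnn.
- by apply/pidealE; exists 1; rewrite mul1r exprS.
- by move=> v /pidealE[c ->]; exists c; rewrite subrr rpred0.
Qed.

Lemma rlen_cyclic m k :
  rlen (rad p k (full_submod (cyclic_mod p m))) (full_submod _) (minn m k).
Proof.
apply: rlen_push (rlen_pideal (minn m k)).
apply: (surj_subquo (f := quot_proj (pideal (p ^+ m)))) => // [y|x].
  exact: quot_proj_surj.
rewrite rad_fullE pidealE; split=> [[z]|].
  have [a ->] := quot_proj_surj z; rewrite -linearZ => /quot_proj_eq/pidealE[c].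
  rewrite -[p ^+ k *: a]/(p ^+ k * a) => /(canRL (subrK _)) ->.
  exists (c * p ^+ (m - minn m k) + a * p ^+ (k - minn m k)).
  by rewrite mulrDl -!mulrA -!exprD !subnK ?geq_minl ?geq_minr // [a * _]mulrC.
move=> [c ->]; case: (leqP m k) => mk.
  exists 0; rewrite scaler0; apply/quot_proj_eq0/pidealE; by exists c.
by exists (quot_proj _ (c : R^o)); rewrite -linearZ; congr (quot_proj _ _); rewrite mulrC.
Qed.

Lemma rlen_Nmod s k :
  rlen (rad p k (full_submod (Nmod p s))) (full_submod _) (sumn [seq minn j k | j <- s]).
Proof.
elim: s => [|m s IH] /=.
  suff -> : rad p k (full_submod 'rV[R]_0) = full_submod _ by exact: rlen0.
  apply: submod_antisym => // x _; apply/rad_fullE; exists x.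
  by rewrite [LHS]thinmx0 [RHS]thinmx0.
(* [W] is the full first factor times [p^k] of the second, so each of the two steps is computed in
   one factor. *)
pose W := pull_submod (snd : {linear (cyclic_mod p m * Nmod p s)%type -> _}) (full_submod _)
  (rad p k (full_submod (Nmod p s))).
have WE z : z \in W <-> z.2 \in rad p k (full_submod (Nmod p s)).
  by rewrite pullE; split=> [[]|].
apply: (rlen_trans (V := W)).
  apply: (rlen_pull (f := fst)) (rlen_cyclic m k); split=> //.
  - by move=> _ /rad_fullE[a ->]; apply/WE/rad_fullE; exists a.2.
  - move=> [x y] /WE/rad_fullE[b /= yb]; rewrite !rad_fullE; split=> [[a ax]|[[a c] [ax _]]].
      by exists (a, b); rewrite ax yb.
    by exists a.
  - by move=> y _; exists (y, 0); [apply/WE; exact: rpred0|rewrite subrr rpred0].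
apply: (rlen_pull (f := snd)) IH; apply: surj_subquo => // [y|x].
  by exists (0, y).
by rewrite WE.
Qed.

End Structure.

Section StructureTheorem.
Variables (R : idomainType) (p : R).
Hypotheses (dvr : is_dvr R) (pmax : maximal_ideal (pideal p)).

(* Take N maximal with zero intersection with Rx.  If y is outside N + Rx and
   p y = u + r x with u in N, then p divides r since x has maximal order, and
   adding y - (r / p) x to N contradicts maximality. *)
Lemma line_complement (M : lmodType R) m (x : M) : finite_length M ->
  (forall z : M, p ^+ m.+1 *: z = 0) -> p ^+ m *: x != 0 ->
  exists N : submodClosed M,
    (forall y, y \in N -> y \in line_submod x -> y = 0) /\
    (forall y, exists2 u, u \in N & y - u \in line_submod x).
Proof.
move=> fM Mkill px.
pose indep (N : submodClosed M) := forall y, y \in N -> y \in line_submod x -> y = 0.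
pose P n := `[< exists2 N, indep N & slen N = n >].
have exP : exists n, P n.
  by exists (slen (zero_submod M)); apply/asboolP; exists (zero_submod M) => // y /zero_submodE.
have ubP n : P n -> (n <= slen (full_submod M))%N.
  by move=> /asboolP[N _ <-]; exact: leq_slen.
case: (ex_maxnP exP ubP) => _ /asboolP[N Ni <-] Nmax; exists N; split=> // y0.
apply/sumE; set S := sum_submod N (line_submod x); apply: contrapT => y0S.
have [y yS pyS] : exists2 y, ~ (y \in S) & p *: y \in S.
  have exk : exists k, p ^+ k *: y0 \in S by exists m.+1; rewrite Mkill rpred0.
  case: (ex_minnP exk) => -[|k]; first by rewrite expr0 scale1r.
  rewrite exprS -scalerA => h kmin; exists (p ^+ k *: y0) => // /kmin.
  by rewrite ltnn.
have [u uN /lineE[r er]] := (sumE _ _ _).1 pyS.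
have [r' er'] : exists r', r = r' * p.
  (* [p^m r x = - p^m u] lies in [N] and on the line, hence vanishes; so [p^(m+1)] divides
     [p^m r]. *)
  have [|c] := ann_order dvr pmax px (r := p ^+ m * r).
    rewrite -scalerA; apply: Ni; last by apply/lineE; exists (p ^+ m * r); rewrite scalerA.
    by rewrite -er scalerBr scalerA -exprSr Mkill sub0r -scaleN1r !rpredZ.
  rewrite exprS mulrA [c * p * _]mulrC => /(mulfI (expf_neq0 m (dvr_neq0 dvr pmax))) ->.
  by exists c.
pose z := y - r' *: x.
have zS : ~ (z \in S).
  move=> zS; apply: yS; rewrite -(subrK (r' *: x) y) rpredD //.
  by apply/sum_subr/lineE; exists r'.
have pzN : p *: z \in N.
  by rewrite /z scalerBr scalerA [p * _]mulrC -er' -er subKr.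
(* Let [w = v + a z] be on the line. If [p] divides [a], then [w] is in [N] because [p z] is;
   otherwise [a] is a unit and [z] would lie in [N + Rx]. *)
have zi : indep (sum_submod N (line_submod z)).
  move=> w /sumE[v vN /lineE[a ea]] wx;
  have [[b eb]|/(dvr_unit dvr pmax) au] := pselect (exists b, a = b * p).
    by apply: Ni => //; rewrite -(subrK v w) ea eb -scalerA rpredD // rpredZ.
  case: zS; rewrite -[z]scale1r -(mulVr au) -scalerA -ea rpredZ //.
  by rewrite submodB //; [exact: sum_subr|exact: sum_subl].
have := Nmax (slen (sum_submod N (line_submod z))); rewrite leqNgt => /(_ _)/negP; case.
  by apply/asboolP; exists (sum_submod N (line_submod z)).
rewrite ltn_neqAle leq_slen //; last exact: sum_subl.
rewrite andbT; apply/eqP => /(slen_eq fM (@sum_subl _ _ _ _)) e; case: zS.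
apply: sum_subl; rewrite e; exact/sum_subr/line_id.
Qed.

(** [M] is the direct sum of [Rx] and [N], and by [ann_order] the annihilator of [x] is generated by
    [p^(m+1)]. This power also kills [N], so the extended list stays decreasing. *)
Lemma split_line (M : lmodType R) m (x : M) (N : submodClosed M) s :
  (forall z : M, p ^+ m.+1 *: z = 0) -> p ^+ m *: x != 0 ->
  (forall y, y \in N -> y \in line_submod x -> y = 0) ->
  (forall y, exists2 u, u \in N & y - u \in line_submod x) ->
  has_type p (submod_of N) s -> has_type p M (m.+1 :: s).
Proof.
move=> Mkill px Ni Ns [/andP[ss s1] [h hb]].
have [h' [hK h'K]] := lmod_iso_sym hb.
split.
  rewrite /is_partition /= s1 andbT path_sortedE ?ss ?andbT; last first.
    by move=> b a c ab bc; exact: leq_trans bc ab.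
  apply/(Nmod_kill dvr pmax) => z; rewrite -[z]h'K -linearZ.
  suff -> : p ^+ m.+1 *: h' z = 0 by rewrite raddf0.
  apply: val_inj; rewrite raddf0; exact: Mkill.
have scale_linear : linear (fun r : R^o => r *: x).
  by move=> a r r'; rewrite scalerDl scalerA.
have [|phi phiE] := @quot_lift _ _ (pideal (p ^+ m.+1)) _ (mk_linear scale_linear).
  by move=> _ /pidealE[c ->] /=; rewrite -scalerA Mkill scaler0.
pose g (w : Nmod p (m.+1 :: s)) : M := phi w.1 + val (h' w.2).
have g_linear : linear g.
  by move=> a w w'; rewrite /g /= !linearP scalerDr addrACA.
suff gb : bijective (mk_linear g_linear).
  by have [f [fK Kf]] := lmod_iso_sym gb; exists f, g.
apply: inj_surj_bijective => [|y].
  apply: raddf_inj => -[q z]; have [r ->] := quot_proj_surj q.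
  rewrite /= /g /= phiE /= => e.
  have hN : val (h' z) \in N by exact: valP.
  have rx0 : r *: x = 0.
    apply: Ni; last by apply/lineE; exists r.
    by rewrite -(addr0_eq (etrans (addrC _ _) e)) -scaleN1r rpredZ.
  have z0 : z = 0.
    rewrite -[z]h'K; suff -> : h' z = 0 by rewrite raddf0.
    by apply: val_inj; rewrite raddf0 -e rx0 add0r.
  have [c ec] := ann_order dvr pmax px rx0.
  apply/pair_equal_spec; split=> //; apply/quot_proj_eq0/pidealE.
  by exists c.
have [u uN /lineE[r e]] := Ns y.
exists (quot_proj _ (r : R^o), h (SubmodOf uN)); rewrite /= /g /= phiE hK /=.
by rewrite -e subrK.
Qed.

Lemma has_type_exists n (M : lmodType R) :
  rlen (zero_submod M) (full_submod M) n -> exists s, has_type p M s.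
Proof.
elim/ltn_ind: n M => n IH M hn.
have fM : finite_length M by exists n; apply/has_lengthE.
have exk : exists k, `[< forall x : M, p ^+ k *: x = 0 >].
  by have [k hk] := finite_length_kill dvr pmax fM; exists k; apply/asboolP.
(* The least exponent killing [M]: 0 means [M = 0], while [m + 1] yields an [x] of maximal order. *)
case: (ex_minnP exk) => -[|m] /asboolP Mkill kmin.
  exists [::]; split=> //.
  have z0 (x : M) : x = 0 by have := Mkill x; rewrite expr0 scale1r.
  exists (mk_linear (f := fun=> 0 : 'rV[R]_0) (fun a x y => esym (thinmx0 _))).
  by exists (fun=> 0) => x; rewrite ?[x]z0 //= thinmx0.
have [x /eqP px] : exists x : M, p ^+ m *: x <> 0.
  by apply/existsNP => h; have := kmin m (asboolT h); rewrite ltnn.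
have [N [Ni Ns]] := line_complement fM Mkill px.
have [||s hs] := IH (slen N) _ (submod_of N).
- rewrite -(slenP hn) ltn_neqAle leq_slen // andbT; apply/eqP => e.
  have eN : N = full_submod M by exact: slen_eq.
  by move/eqP: px; case; apply: Ni; [rewrite eN|apply/rpredZ/line_id].
- exact: rlen_pull (submod_of_subquo N) (slen_rlen fM N).
- by exists (m.+1 :: s); exact: split_line Mkill px Ni Ns hs.
Qed.

End StructureTheorem.

Section Mtype.
Variables (R : idomainType) (p : R).
Hypotheses (dvr : is_dvr R) (pmax : maximal_ideal (pideal p)).

Lemma mtypeP (M : lmodType R) : finite_length M -> has_type p M (mtype p M).
Proof.
move=> [n /has_lengthE /(has_type_exists dvr pmax) h].
exact: (@xgetPex _ [::] [set l | has_type p M l]%classic).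
Qed.

(** The length of [M / p^k M], by [rlen_rad], but computed from the type. *)
Definition rad_colen (M : lmodType R) k := sumn [seq minn j k | j <- mtype p M].

Lemma rlen_rad (M : lmodType R) k : finite_length M ->
  rlen (rad p k (full_submod M)) (full_submod M) (rad_colen M k).
Proof.
move=> /mtypeP[_ [f fb]]; apply: rlen_pull (rlen_Nmod dvr pmax (mtype p M) k).
have [g [fK gK]] := lmod_iso_sym fb.
apply: (surj_subquo (f := f)) => // [y|x]; first by exists (g y); rewrite gK.
rewrite !rad_fullE; split=> [[a e]|[a ->]]; last by exists (f a); rewrite linearZ.
by exists (g a); rewrite -[x]fK e linearZ.
Qed.

Lemma mtype_eq (M M' : lmodType R) : finite_length M -> finite_length M' ->
  (mtype p M = mtype p M' <-> forall k, rad_colen M k = rad_colen M' k).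
Proof.
move=> /mtypeP[tM _] /mtypeP[tM' _]; split=> [e k|]; first by rewrite /rad_colen e.
exact: sum_minn_inj.
Qed.

(** The largest part is the exponent of [M]; the default 0 is right for the zero module, whose type
    is empty. *)
Lemma head_mtype (M : lmodType R) i : finite_length M ->
  (head 0%N (mtype p M) <= i)%N <-> forall x : M, p ^+ i *: x = 0.
Proof.
move=> /mtypeP[/andP[sM _] [f fb]]; have [g [fK gK]] := lmod_iso_sym fb.
have -> : (head 0%N (mtype p M) <= i)%N = all (fun m => m <= i)%N (mtype p M).
  case: (mtype p M) sM => //= m s; rewrite path_sortedE; last first.
    by move=> b a c ab bc; exact: leq_trans bc ab.
  move=> /andP[/allP ms _]; case: leqP => //= mi; apply/esym/allP => j /ms jm.
  exact: leq_trans jm mi.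
rewrite -(Nmod_kill dvr pmax); split=> h x.
  by rewrite -[x]fK -linearZ h raddf0.
by rewrite -[x]gK -linearZ h raddf0.
Qed.

End Mtype.

(** * Hom-matrix and socle tableau *)

(** The length of a tableau encodes [alpha1], so equal tableaux have equal bounds. *)
Lemma mkseqS_eq (T : Type) (f g : nat -> T) m n :
  mkseq f m.+1 = mkseq g n.+1 <-> m = n /\ forall i, (i <= m)%N -> f i = g i.
Proof.
split=> [e|[<- fg]]; last first.
  by apply: (@eq_from_nth _ (f 0%N)); rewrite ?size_mkseq // => i im; rewrite !nth_mkseq ?fg.
have emn : m = n by have := congr1 size e; rewrite !size_mkseq => -[].
split=> // i im; have := congr1 (fun s => nth (f 0%N) s i) e.
by rewrite !nth_mkseq -?emn.
Qed.

Section FiniteLength.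
Variables (R : pzRingType) (M : lmodType R) (N : submodClosed M).
Hypothesis fM : finite_length M.

Lemma submod_of_finite : finite_length (submod_of N).
Proof.
exists (slen N); apply/has_lengthE.
exact: rlen_pull (submod_of_subquo N) (slen_rlen fM N).
Qed.

Lemma quotmod_subquo (U V : submodClosed M) (U' V' : submodClosed (quotmod N)) :
  {subset U <= V} ->
  (forall x, quot_proj N x \in U' <-> x \in U) ->
  (forall x, quot_proj N x \in V' <-> x \in V) ->
  subquo_iso (quot_proj N) U V U' V'.
Proof. by move=> UV hU hV; apply: surj_subquo => //; exact: quot_proj_surj. Qed.

Lemma quotmod_finite : finite_length (quotmod N).
Proof.
have [//|n h _] := rlen_slen fM (_ : {subset N <= full_submod M}).
exists n; apply/has_lengthE; apply: rlen_push h.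
by apply: quotmod_subquo => // x; rewrite zero_submodE quot_proj_eq0.
Qed.

End FiniteLength.

Section Invariants.
Variables (R : idomainType) (p : R).
Hypotheses (dvr : is_dvr R) (pmax : maximal_ideal (pideal p)).

(** Multiplication by [p^k] identifies [M / soc^k M] with [p^k M], so [soc^k M] and [M / p^k M] have
    the same length. *)
Lemma slen_soc (M : lmodType R) k : finite_length M ->
  slen (soc p k (full_submod M)) = rad_colen p M k.
Proof.
move=> fM; have [//|n h e] := rlen_slen fM
  (_ : {subset soc p k (full_submod M) <= full_submod M}).
have [//|n' h' e'] := rlen_slen fM
  (_ : {subset rad p k (full_submod M) <= full_submod M}).
have en : slen (rad p k (full_submod M)) = n.
  apply: slenP; apply: rlen_push h.
  have sl : linear (fun x : M => p ^+ k *: x).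
    by move=> a x y; rewrite scalerDr !scalerA mulrC.
  split=> [//||x _|x _|y /rad_fullE[x ->]]; first exact: zero_submod_sub.
  - by apply/rad_fullE; exists x.
  - by rewrite zero_submodE socE; split=> [|[]].
  - by exists x; rewrite //= subrr rpred0.
rewrite -(rlen_inj h' (rlen_rad dvr pmax k fM)); apply: (@addIn n).
by rewrite -e e' en addnC.
Qed.

Section Picket.
Variable X : embedding R.
Implicit Types (m i k l : nat).
Let B := ambient X.
Let A : submodClosed B := emb_sub X.

Fact picket_val0 m i : p ^+ m *: (0 : B) = 0 /\ p ^+ i *: (0 : B) \in A.
Proof. by rewrite !scaler0 rpred0. Qed.
Fact picket_valL m i (a : R) (x y : B) :
  p ^+ m *: x = 0 /\ p ^+ i *: x \in A -> p ^+ m *: y = 0 /\ p ^+ i *: y \in A ->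
  p ^+ m *: (a *: x + y) = 0 /\ p ^+ i *: (a *: x + y) \in A.
Proof.
move=> [x0 xA] [y0 yA]; rewrite !scalerDr !scalerA ![_ * a]mulrC -!scalerA x0 y0.
by rewrite scaler0 addr0; split=> //; apply: rpredD => //; exact: rpredZ.
Qed.
(* The images of the generator under the morphisms from the picket [P^m_(m-i)]. *)
Definition picket_vals m i : submodClosed B :=
  psub (picket_val0 m i) (@picket_valL m i).

Lemma picket_valsE m i b :
  b \in picket_vals m i <-> p ^+ m *: b = 0 /\ p ^+ i *: b \in A.
Proof. exact: psubE. Qed.

Definition picket_len m i := slen (picket_vals m i).

Lemma picket_len0 i : picket_len 0 i = 0%N.
Proof.
rewrite -[RHS](slen0 B); congr slen; apply: submod_antisym => b.
  by move=> /picket_valsE[]; rewrite expr0 scale1r => -> _; exact: rpred0.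
exact: zero_submod_sub.
Qed.

Lemma picket_len_diag m i : (m <= i)%N -> picket_len m i = picket_len m m.
Proof.
move=> mi; congr slen; apply: submod_antisym => b /picket_valsE[b0 _];
  apply/picket_valsE; split; rewrite ?b0 ?rpred0 //.
by rewrite -(subnK mi) exprD -scalerA b0 scaler0 rpred0.
Qed.

Lemma soc_picket_vals i : soc p i A = picket_vals i 0.
Proof.
by apply: submod_antisym => b; rewrite socE picket_valsE expr0 scale1r => -[].
Qed.

Hypothesis fB : finite_length B.

Lemma hom_matrixE m l : (l <= m)%N -> hom_matrix p X m l = picket_len m (m - l).
Proof.
move=> lm; apply: lenP; set P := picket p m l.
pose gen : ambient P := quot_proj (pideal (p ^+ m)) (1 : R^o).
have genE (q : ambient P) : exists r, q = r *: gen.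
  have [r ->] := quot_proj_surj q; exists r.
  by rewrite -linearZ; congr (quot_proj _ _); rewrite -[RHS]/(r * 1) mulr1.
pose ev (f : homS P X) : B := hom_fun (val f) gen.
have ev_linear : linear ev by [].
apply: rlen_pull (slen_rlen fB (picket_vals m (m - l))).
apply: (inj_subquo (f := mk_linear ev_linear)) => [f g /= e|y].
  apply/val_inj/val_inj/funext => q; have [r ->] := genE q.
  rewrite -[LHS]/(hom_fun (val f) _) -[RHS]/(hom_fun (val g) _) !linearZ.
  by congr (_ *: _).
rewrite picket_valsE; split=> [[y0 yA]|[f ->]].
  have sl : linear (fun r : R^o => r *: y).
    by move=> a r r'; rewrite scalerDl scalerA.
  have [|phi phiE] := @quot_lift _ _ (pideal (p ^+ m)) _ (mk_linear sl).
    by move=> _ /pidealE[c ->] /=; rewrite -scalerA y0 scaler0.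
  have phiS : hom_of phi \in homS_pred (X := P) (Y := X).
    apply/asboolP => q /socE[_]; have [r ->] := quot_proj_surj q.
    rewrite -linearZ => /quot_proj_eq0/pidealE[c e].
    rewrite -[hom_fun _ _]/(phi _) phiE /=.
    (* An element [r] of [soc^l] satisfies [p^l r = c p^m]; cancelling [p^l] shows that [p^(m-l)]
       divides it. *)
    have [d ->] : exists d, r = d * p ^+ (m - l).
      exists c; apply: (mulfI (expf_neq0 l (dvr_neq0 dvr pmax))).
      by rewrite mulrCA -exprD subnKC.
    by rewrite -scalerA rpredZ.
  exists (SubmodOf phiS); rewrite /= /ev.
  by rewrite -[hom_fun _ _]/(phi _) phiE /= scale1r.
have fS : forall q, q \in emb_sub P -> hom_fun (val f) q \in A by apply/asboolP; exact: (valP f).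
have kill : p ^+ m *: gen = 0.
  rewrite -linearZ; apply/quot_proj_eq0/pidealE; exists 1.
  by rewrite -[LHS]/(_ * 1) mulrC.
have evZ c : c *: ev f = hom_fun (val f) (c *: gen) by rewrite linearZ.
rewrite /= !evZ kill raddf0; split=> //; apply: fS; apply/socE; split=> //.
by rewrite scalerA -exprD subnKC.
Qed.

Lemma socle_type k i :
  picket_len (k + i) k =
  (picket_len i 0 + rad_colen p (quotmod (soc p i A)) k)%N.
Proof.
have si : {subset soc p i A <= picket_vals (k + i) k}.
  move=> b /socE[bA b0]; apply/picket_valsE.
  by rewrite exprD -scalerA b0 scaler0 rpredZ.
have [n h e] := rlen_slen fB si; rewrite /picket_len -(soc_picket_vals i) e.
congr (_ + _)%N; rewrite -slen_soc; last exact: quotmod_finite.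
apply/esym/slenP; apply: rlen_push h; apply: quotmod_subquo => // x.
  by rewrite zero_submodE quot_proj_eq0.
rewrite !socE picket_valsE -linearZ quot_proj_eq0 socE scalerA -exprD addnC.
by split=> [[_ []]|[]].
Qed.

Lemma alpha1_kill i :
  (alpha1 p X <= i)%N <-> forall a, a \in A -> p ^+ i *: a = 0.
Proof.
rewrite (head_mtype dvr pmax); last exact: submod_of_finite.
split=> [h a aA|h x].
  exact: (congr1 (@submod_val _ _ _) (h (SubmodOf aA))).
by apply: val_inj; rewrite raddf0; apply: h; exact: valP.
Qed.

(** Once [p^k b] lies in [A] it is killed by [p^alpha1], so the torsion condition is automatic. *)
Lemma picket_len_alpha1 k i : (alpha1 p X <= i)%N ->
  picket_len (k + i) k = picket_len (k + alpha1 p X) k.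
Proof.
move=> Xi; congr slen; apply: submod_antisym => b /picket_valsE[_ bA];
  apply/picket_valsE; split=> //; rewrite addnC exprD -scalerA.
  by apply: (alpha1_kill _).1 bA.
exact: (alpha1_kill _).1 bA.
Qed.

(** The chain of the [soc^m A] is constant from [m = i] on exactly when [soc^i A = A]; for one
    direction, compare [i] with an exponent killing [B]. Thus the picket lengths determine
    [alpha1]. *)
Lemma alpha1_picket i :
  (alpha1 p X <= i)%N <-> forall m, (i <= m)%N -> picket_len m 0 = picket_len i 0.
Proof.
rewrite alpha1_kill; split=> [h m im|h a aA].
  congr slen; apply: submod_antisym => b; rewrite !picket_valsE !expr0 !scale1r => -[b0 bA].
    by split=> //; exact: h.
  by rewrite -(subnK im) exprD -scalerA b0 scaler0.
have [n kn] := finite_length_kill dvr pmax fB.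
have e : picket_vals i 0 = picket_vals (maxn i n) 0.
  apply: slen_eq => // [b|]; last by rewrite [RHS]h ?leq_maxl.
  rewrite !picket_valsE !expr0 !scale1r => -[_ bA]; split=> //.
  by rewrite -(subnK (leq_maxr i n)) exprD -scalerA kn scaler0.
have : a \in picket_vals (maxn i n) 0.
  apply/picket_valsE; rewrite expr0 scale1r; split=> //.
  by rewrite -(subnK (leq_maxr i n)) exprD -scalerA kn scaler0.
by rewrite -e => /picket_valsE[].
Qed.

End Picket.

Section Equivalences.
Variables X Y : embedding R.
Hypotheses (fX : finite_length (ambient X)) (fY : finite_length (ambient Y)).

(** The Hom-matrix covers [1 <= m] and [i <= m]. The row [m = 0] vanishes, and beyond the diagonal
    each row is constant. *)
Lemma hom_matrix_picket :
  (forall m l, (1 <= m)%N -> (l <= m)%N -> hom_matrix p X m l = hom_matrix p Y m l) <->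
  forall m i, picket_len X m i = picket_len Y m i.
Proof.
split=> [h m i|h m l _ lm]; last by rewrite !hom_matrixE.
have [->|m0] := posnP m; first by rewrite !picket_len0.
suff hi j : (j <= m)%N -> picket_len X m j = picket_len Y m j.
  by have [im|/ltnW mi] := leqP i m; [exact: hi | rewrite !(picket_len_diag _ mi) hi].
by move=> jm; rewrite -(subKn jm) -!hom_matrixE ?leq_subr // h ?leq_subr.
Qed.

Lemma socle_tableau_picket :
  socle_tableau p X = socle_tableau p Y <->
  forall m i, picket_len X m i = picket_len Y m i.
Proof.
rewrite mkseqS_eq; split=> [[ea et]|h]; last first.
  split=> [|i _].
    apply/eqP; rewrite eqn_leq; apply/andP.
    split; [apply/(alpha1_picket fX)|apply/(alpha1_picket fY)] => m im.
      by rewrite !h; exact: (alpha1_picket fY _).1.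
    by rewrite -!h; exact: (alpha1_picket fX _).1.
  apply/(mtype_eq dvr pmax) => // [||k]; try exact: quotmod_finite.
  by apply: (@addnI (picket_len X i 0)); rewrite -socle_type // h h socle_type.
have ht i k : (i <= alpha1 p X)%N ->
    rad_colen p (quotmod (soc p i (emb_sub X))) k =
    rad_colen p (quotmod (soc p i (emb_sub Y))) k.
  by move=> /et e; rewrite /rad_colen e.
have hdiag k : picket_len X k k = picket_len Y k k.
  by have := socle_type fX k 0; have := socle_type fY k 0;
    rewrite !addn0 !picket_len0 ht // => -> ->.
have hfull i : (i <= alpha1 p X)%N -> picket_len X i 0 = picket_len Y i 0.
  move=> iX; have [nX kX] := finite_length_kill dvr pmax fX.
  have [nY kY] := finite_length_kill dvr pmax fY.
  (* [nX + nY] is an exponent that kills both ambient modules, so both submodules compared here are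
     all of [ambient Z]. *)
  have stable (Z : embedding R) n : (forall x : ambient Z, p ^+ n *: x = 0) ->
      (n <= nX + nY)%N ->
      picket_len Z (nX + nY + i) (nX + nY) = picket_len Z (nX + nY) (nX + nY).
    move=> kZ nle; have kill x : p ^+ (nX + nY) *: (x : ambient Z) = 0.
      by rewrite -(subnK nle) exprD -scalerA kZ scaler0.
    congr slen; apply: submod_antisym => b /picket_valsE[_ bZ]; apply/picket_valsE.
      by rewrite kill rpred0.
    by split=> //; rewrite addnC exprD -scalerA kill scaler0.
  have := socle_type fX (nX + nY) i; have := socle_type fY (nX + nY) i.
  rewrite (stable X nX) ?leq_addr // (stable Y nY) ?leq_addl // -hdiag ht // => ->.
  by move=> /addIn.
move=> m j; have [jm|/ltnW mj] := leqP j m; last by rewrite !(picket_len_diag _ mj).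
have hle i k : (i <= alpha1 p X)%N -> picket_len X (k + i) k = picket_len Y (k + i) k.
  by move=> iX; rewrite !socle_type // hfull // ht.
(* The pair [(m, j)] is read at index [m - j] of the tableau, replaced by [alpha1] when it exceeds
   that. *)
rewrite -(subnKC jm); have [|/ltnW iX] := leqP (m - j) (alpha1 p X); first exact: hle.
by rewrite !picket_len_alpha1 -?ea // hle.
Qed.
End Equivalences.
End Invariants.

(** * Duality *)

Section Dual.
Variables (R : idomainType) (p : R).
Hypotheses (dvr : is_dvr R) (pmax : maximal_ideal (pideal p)).
Variables (E : lmodType R) (iota : {linear quotmod (pideal p) -> E}).
Hypothesis env : injective_envelope iota.

(** By essentiality the line [Re] meets the image of [iota] in a nonzero element, which comes from
    the class of a unit. *)
Lemma envelope_soc_gen (e : E) : p *: e = 0 -> e != 0 ->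
  exists c, iota (quot_proj _ (1 : R^o)) = c *: e.
Proof.
move=> pe e0; have [x [ex ix]] : exists x, iota x \in line_submod e /\ iota x <> 0.
  apply: contrapT => h; case/eqP: e0; apply/zero_submodE.
  have l0 : line_submod e =i pred1 0.
    apply: (envelope_essential env) => x xe; apply: contrapT => x0.
    by apply: h; exists x.
  by have := line_id e; rewrite l0 => /eqP ->; exact: rpred0.
have [r er] := quot_proj_surj x; have [c ec] := (lineE _ _).1 ex.
have ru : r \is a GRing.unit.
  apply: (dvr_unit dvr pmax) => -[d ed]; apply: ix.
  suff -> : x = 0 by rewrite raddf0.
  by rewrite er; apply/quot_proj_eq0/pidealE; exists d.
exists (r^-1 * c); rewrite -scalerA -ec -linearZ; congr (iota _).
by rewrite er -linearZ; congr (quot_proj _ _); rewrite -[RHS]/(_ * _) mulVr.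
Qed.

(** Two nonzero socle elements both have the image of 1 as a multiple; the coefficient at [e'] is a
    unit because that image is nonzero. *)
Lemma envelope_soc_line (e e' : E) : p *: e = 0 -> e != 0 -> p *: e' = 0 ->
  exists c, e' = c *: e.
Proof.
move=> pe e0 pe'; have [->|e'0] := eqVneq e' 0; first by exists 0; rewrite scale0r.
have [c ec] := envelope_soc_gen pe e0; have [c' ec'] := envelope_soc_gen pe' e'0.
have cu : c' \is a GRing.unit.
  apply: (dvr_unit dvr pmax) => -[d ed].
  have /quot_proj_eq0/pidealE[b] : quot_proj (pideal p) (1 : R^o) = 0.
    apply: (envelope_mono env); rewrite ec' ed -scalerA pe' scaler0 raddf0 //.
  by move=> /esym; exact: dvr_neq1.
by exists (c'^-1 * c); rewrite -scalerA -ec ec' scalerA mulVr // scale1r.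
Qed.

(** * Annihilators in Hom(M, E) *)

Section Perp.
Variable M : lmodType R.
Implicit Types (U V W : submodClosed M) (g h : hom_mod M E).

Lemma hom_eq g h : (forall x, hom_fun g x = hom_fun h x) -> g = h.
Proof. by move=> gh; apply/val_inj/funext. Qed.

Lemma hom_funZ g (a : R) x : hom_fun g (a *: x) = a *: hom_fun g x.
Proof. exact: linearZ. Qed.

Lemma hom_funD g x y : hom_fun g (x + y) = hom_fun g x + hom_fun g y.
Proof. exact: linearD. Qed.

Fact perp0 U x : x \in U -> hom_fun (0 : hom_mod M E) x = 0.
Proof. by []. Qed.
Fact perpL U (a : R) g h : (forall x, x \in U -> hom_fun g x = 0) ->
  (forall x, x \in U -> hom_fun h x = 0) ->
  forall x, x \in U -> hom_fun (a *: g + h) x = 0.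
Proof.
move=> g0 h0 x xU; rewrite -[LHS]/(a *: hom_fun g x + hom_fun h x).
by rewrite g0 // h0 // scaler0 addr0.
Qed.
Definition perp U : submodClosed (hom_mod M E) := psub (@perp0 U) (@perpL U).
Lemma perpE U g : g \in perp U <-> forall x, x \in U -> hom_fun g x = 0.
Proof. exact: psubE. Qed.

(** Modulo functionals killing [V], a functional killing [U] is determined by its value at a
    generator [x] of [V / U], and that value lies in the one-dimensional socle of [E]. *)
Lemma cover_perp U V : cover U V -> cover (perp V) (perp U).
Proof.
move=> cUV; have [UV nVU _] := cUV.
have /existsNP[x /not_implyP[xV /negP xU]] := nVU.
have pV v : v \in V -> p *: v \in U by exact: (cover_p dvr pmax cUV).
have sl : linear (fun r : R^o => r *: quot_proj U x).
  by move=> a r r'; rewrite scalerDl scalerA.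
(* The class of [x] spans a copy of [R / (p)] in [M / U]; extending [iota] from it gives a
   functional that kills [U] but not [x]. *)
have [|theta thetaE] := @quot_lift _ _ (pideal p) _ (mk_linear sl).
  move=> _ /pidealE[c ->] /=; rewrite -linearZ -scalerA.
  by apply/quot_proj_eq0/rpredZ/pV.
have theta_inj : injective theta.
  apply: raddf_inj => q; have [r ->] := quot_proj_surj q => theta0.
  have : r *: quot_proj U x = 0 := etrans (esym (thetaE r)) theta0.
  rewrite -linearZ => /quot_proj_eq0 rxU; apply/quot_proj_eq0/pidealE; apply: contrapT.
  move=> /(dvr_unit dvr pmax) ru; move/negP: xU; case.
  by rewrite -[x]scale1r -(mulVr ru) -scalerA rpredZ.
have [g gE] := envelope_injective env iota theta_inj.
pose g0 : hom_mod M E := hom_of (g \o quot_proj U).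
have g0E y : hom_fun g0 y = g (quot_proj U y) by [].
have g0U u : u \in U -> hom_fun g0 u = 0.
  by move=> /quot_proj_eq0 uU; rewrite g0E uU raddf0.
have g0x : hom_fun g0 x != 0.
  apply/eqP; rewrite g0E -[quot_proj U x]scale1r.
  rewrite -[1 *: _]/(mk_linear sl 1) -thetaE gE -(raddf0 iota).
  move=> /(envelope_mono env)/quot_proj_eq0/pidealE[c /esym].
  exact: dvr_neq1.
have pev h : h \in perp U -> forall v, v \in V -> p *: hom_fun h v = 0.
  by move=> /perpE hU v vV; rewrite -hom_funZ hU // pV.
have g0P : g0 \in perp U by exact/perpE.
apply: (cover_intro dvr pmax (x := g0)) => //.
- by move=> h /perpE hV; apply/perpE => u /UV; exact: hV.
- by apply/negP => /perpE/(_ x xV); exact/eqP.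
- by apply/perpE => v vV; exact: (pev g0 g0P v vV).
- move=> h hP; have [c ec] := envelope_soc_line (pev _ g0P x xV) g0x (pev _ hP x xV).
  exists c; apply/perpE => v vV; have [d vd] := cover_gen cUV xV xU vV.
  rewrite -[LHS]/(hom_fun h v - c *: hom_fun g0 v) -(subrK (d *: x) v).
  move: (v - d *: x) vd => u uU; rewrite !hom_funD !hom_funZ ec (g0U u uU) ((perpE _ _).1 hP u uU).
  by rewrite !add0r !scalerA mulrC subrr.
Qed.

Lemma rlen_perp U V n : rlen U V n -> rlen (perp V) (perp U) n.
Proof.
elim=> [|{}V W m _ IH VW]; first exact: rlen0.
by rewrite -add1n; apply: rlen_trans IH; exact/cover_rlen/cover_perp.
Qed.

Lemma perp_full : perp (full_submod M) = zero_submod _.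
Proof.
apply: submod_antisym => g; last exact: zero_submod_sub.
by move=> /perpE h; apply/zero_submodE/hom_eq => x; exact: h.
Qed.

Lemma perp_zero : perp (zero_submod M) = full_submod _.
Proof.
apply: submod_antisym => // g _; apply/perpE => x /zero_submodE ->.
by rewrite raddf0.
Qed.

Lemma hom_mod_finite : finite_length M -> finite_length (hom_mod M E).
Proof.
move=> [n /has_lengthE h]; exists n; apply/has_lengthE.
by rewrite -perp_full -perp_zero; exact: rlen_perp.
Qed.

End Perp.

Section DualEmbedding.
Variable X : embedding R.
Let B := ambient X.
Let A : submodClosed B := emb_sub X.
Let DX := dual_emb E X.
Let DC : submodClosed (hom_mod B E) := emb_sub DX.

Lemma dual_embE g : g \in DC <-> forall a, a \in A -> hom_fun g a = 0.
Proof.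
split=> [/asboolP[h ->] a aA|g0].
  rewrite -[LHS]/(hom_fun h (quot_proj A a)).
  by have /quot_proj_eq0 -> := aA; rewrite raddf0.
have [|h hE] := @quot_lift _ _ A _ (hom_fun g).
  exact: g0.
by apply/asboolP; exists (hom_of h); apply: hom_eq => x; rewrite -hE.
Qed.

Lemma perp_picket_vals k i :
  perp (picket_vals p X k i) = sum_submod (rad p i DC) (rad p k (full_submod _)).
Proof.
apply: submod_antisym => g; last first.
  move=> /sumE[_ /radE[h hD ->] /rad_fullE[h' e]].
  apply/perpE => b /picket_valsE[b0 bA].
  rewrite -(subrK (p ^+ i *: h) g) e.
  rewrite -[LHS]/(p ^+ k *: hom_fun h' b + p ^+ i *: hom_fun h b).
  by rewrite -!hom_funZ b0 raddf0 add0r; exact: (dual_embE _).1.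
(* The factors [p^i] and [p^k] in [phi] make its kernel exactly [W]. *)
move=> /perpE gW; set W := picket_vals p X k i in gW.
pose phi (b : B) := (p ^+ i *: quot_proj A b, p ^+ k *: b).
have phi_linear : linear phi.
  move=> a x y; apply/pair_equal_spec.
  by split; first rewrite linearP; rewrite scalerDr !scalerA mulrC -!scalerA.
have phi0 b : phi b = 0 <-> b \in W.
  rewrite picket_valsE -[0]/(0, 0) pair_equal_spec -linearZ quot_proj_eq0.
  by split=> -[].
have [|psi psiE] := @quot_lift _ _ W _ (mk_linear phi_linear).
  by move=> b /phi0.
have psi_inj : injective psi.
  apply: raddf_inj => q; have [b ->] := quot_proj_surj q => psi0.
  exact/quot_proj_eq0/phi0/(etrans (esym (psiE b)) psi0).
have [|g' g'E] := @quot_lift _ _ W _ (hom_fun g); first exact: gW.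
have [G GE] := envelope_injective env g' psi_inj.
(* The two components of [G] yield [g = p^i h1 + p^k h2], where [h1] factors through [B / A] and so
   lies in [DC]. *)
have gE b : hom_fun g b = p ^+ i *: G (quot_proj A b, 0) + p ^+ k *: G (0, b).
  rewrite -g'E -GE psiE -!linearZ -linearD; congr (G _); apply/pair_equal_spec.
  by rewrite /= scaler0 scaler0 addr0 add0r.
have l1 : linear (fun b : B => G (quot_proj A b, 0)).
  move=> a x y; rewrite -linearP; congr (G _); apply/pair_equal_spec.
  by rewrite /= linearP scaler0 addr0.
have l2 : linear (fun b : B => G (0, b)).
  move=> a x y; rewrite -linearP; congr (G _); apply/pair_equal_spec.
  by rewrite /= scaler0 addr0.
pose h1 : hom_mod B E := hom_of (mk_linear l1).
pose h2 : hom_mod B E := hom_of (mk_linear l2).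
have -> : g = p ^+ i *: h1 + p ^+ k *: h2 by apply: hom_eq => b; rewrite gE.
apply: rpredD.
  apply/sum_subl/radE; exists h1 => //; apply/dual_embE => a aA.
  rewrite -[LHS]/(G (quot_proj A a, 0)); have /quot_proj_eq0 -> := aA.
  exact: (raddf0 G).
by apply/sum_subr/rad_fullE; exists h2.
Qed.

Hypothesis fB : finite_length B.

Lemma rlen_dual k i :
  rlen (sum_submod (rad p i DC) (rad p k (full_submod _))) (full_submod (hom_mod B E))
    (picket_len p X k i).
Proof.
rewrite -perp_picket_vals -perp_zero; apply: rlen_perp.
exact: slen_rlen.
Qed.

Lemma LR_type k i :
  rad_colen p (quotmod (rad p i (emb_sub DX))) k = picket_len p X k i.
Proof.
have fD : finite_length (quotmod (rad p i (emb_sub DX))).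
  exact/quotmod_finite/hom_mod_finite.
apply: (rlen_inj (rlen_rad dvr pmax k fD)); apply: rlen_push (rlen_dual k i).
apply: quotmod_subquo => // g; rewrite rad_fullE sumE; split=> [[z]|[u uD /rad_fullE[h e]]].
  have [h ->] := quot_proj_surj z; rewrite -linearZ => /quot_proj_eq gh.
  exists (g - p ^+ k *: h); [exact: gh | rewrite subKr; apply/rad_fullE; by exists h].
exists (quot_proj _ h); rewrite -linearZ -e; apply/quot_proj_eq.
by rewrite subKr.
Qed.

(** The bound means [p^i DC = 0]. Then [p^i DC + p^k DB] reduces to [p^k DB], as it always does for
    [i = k]. *)
Lemma alpha1_dual i :
  (alpha1 p DX <= i)%N <-> forall k, picket_len p X k i = picket_len p X k k.
Proof.
have fD := hom_mod_finite fB; rewrite (alpha1_kill dvr pmax) //.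
have sum_rad j k : {subset rad p j DC <= rad p k (full_submod _)} ->
    sum_submod (rad p j DC) (rad p k (full_submod _)) = rad p k (full_submod _).
  move=> jk; apply: submod_antisym; last exact: sum_subr.
  exact: sum_sub.
have sum_kk k : sum_submod (rad p k DC) (rad p k (full_submod _)) = rad p k (full_submod _).
  by apply: sum_rad => _ /radE[a _ ->]; apply/rad_fullE; exists a.
split=> [h k|h g gD].
  have hi := rlen_dual k i; have hk := rlen_dual k k; rewrite sum_kk in hk.
  rewrite sum_rad in hi; first exact: (rlen_inj hi hk).
  by move=> f /radE[a /h a0 ->]; rewrite a0; exact: rpred0.
(* Conversely, take [k = n] with [p^n DB = 0]: the hypothesis says that [p^i DC] has the same
   colength as 0. *)
have [n kn] := finite_length_kill dvr pmax fD.
have [//|m hm e] := rlen_slen fD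
  (_ : {subset sum_submod (rad p i DC) (rad p n (full_submod _)) <=
        full_submod (hom_mod B E)}).
have := rlen_dual n n; rewrite -h sum_kk (rlen_inj (rlen_dual n i) hm).
have rad0 : rad p n (full_submod (hom_mod B E)) = zero_submod _.
  apply: submod_antisym => f; last exact: zero_submod_sub.
  by move=> /rad_fullE[a ->]; rewrite kn rpred0.
rewrite rad0 => /slenP e'; move: e; rewrite e' -[LHS]add0n => /addIn e.
have z0 : zero_submod _ = sum_submod (rad p i DC) (rad p n (full_submod (hom_mod B E))).
  by apply: slen_eq; rewrite // ?slen0 //; exact: zero_submod_sub.
by apply/zero_submodE; rewrite z0; apply/sum_subl/radE; exists g.
Qed.

End DualEmbedding.
End Dual.

Section LRTableau.
Variables (R : idomainType) (p : R).
Hypotheses (dvr : is_dvr R) (pmax : maximal_ideal (pideal p)).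
Variables (E : lmodType R) (iota : {linear quotmod (pideal p) -> E}).
Hypothesis env : injective_envelope iota.
Variables X Y : embedding R.
Hypotheses (fX : finite_length (ambient X)) (fY : finite_length (ambient Y)).

(** The tableau shows the columns [i <= alpha1] of the dual through [LR_type]; every later column
    equals the diagonal, which equals column [alpha1]. *)
Lemma LR_tableau_picket :
  LR_tableau p (dual_emb E X) = LR_tableau p (dual_emb E Y) <->
  forall m i, picket_len p X m i = picket_len p Y m i.
Proof.
rewrite mkseqS_eq; split=> [[ea et]|h]; last first.
  split=> [|i _].
    apply/eqP; rewrite eqn_leq; apply/andP.
    split; [apply/(alpha1_dual dvr pmax env fX)|apply/(alpha1_dual dvr pmax env fY)] => k.
      by rewrite !h; exact: (alpha1_dual dvr pmax env fY _).1.
    by rewrite -!h; exact: (alpha1_dual dvr pmax env fX _).1.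
  apply/(mtype_eq dvr pmax) => [||k]; try exact/quotmod_finite/(hom_mod_finite dvr pmax env).
  by rewrite !(LR_type dvr pmax env) // h.
have hle m i : (i <= alpha1 p (dual_emb E X))%N -> picket_len p X m i = picket_len p Y m i.
  by move=> /et e; rewrite -!(LR_type dvr pmax env) // /rad_colen e.
move=> m i; have [|/ltnW Xi] := leqP i (alpha1 p (dual_emb E X)); first exact: hle.
have Yi : (alpha1 p (dual_emb E Y) <= i)%N by rewrite -ea.
rewrite (alpha1_dual dvr pmax env fX _).1 // (alpha1_dual dvr pmax env fY _).1 //.
rewrite -((alpha1_dual dvr pmax env fX _).1 (leqnn _)).
by rewrite -((alpha1_dual dvr pmax env fY _).1 (leqnn _)) -ea hle.
Qed.

End LRTableau.

Theorem theorem4p1 (R : idomainType) (p : R)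
    (E : lmodType R) (iota : {linear quotmod (pideal p) -> E})
    (X Y : embedding R) :
  is_dvr R -> maximal_ideal (pideal p) -> injective_envelope iota ->
  finite_length (ambient X) -> finite_length (ambient Y) ->
  (socle_tableau p X = socle_tableau p Y <->
   LR_tableau p (dual_emb E X) = LR_tableau p (dual_emb E Y)) /\
  (socle_tableau p X = socle_tableau p Y <->
   forall m l : nat, (1 <= m)%N -> (l <= m)%N ->
     hom_matrix p X m l = hom_matrix p Y m l).
Proof.
move=> dvr pmax env fX fY.
by rewrite (socle_tableau_picket dvr pmax fX fY)
  (LR_tableau_picket dvr pmax env fX fY) (hom_matrix_picket dvr pmax fX fY).
Qed.
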